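(* For each positive integer $n$, let $I_n$ be the number of descents of a permutation chosen uniformly at random among all involutions in the symmetric group $S_n$, and (for $n\ge 2$) let $R_n$ be the number of descents of a permutation chosen uniformly at random among all derangements in $S_n$. Then there exist constants $C, C'>0$, independent of $n$, such that for all $n$ with $\operatorname{Var}(I_n)>0$, $$\sup_{x \in \mathbb{R}} \left| \mathbf{P} \left(\frac{I_n - \mathbf{E}[I_n]}{\sqrt{\operatorname{Var}(I_n)}} \leq x\right) - \Phi(x) \right| \leq \frac{C}{\sqrt{n}},$$ and for all $n$ with $\operatorname{Var}(R_n)>0$, $$\sup_{x \in \mathbb{R}} \left| \mathbf{P} \left(\frac{R_n - \mathbf{E}[R_n]}{\sqrt{\operatorname{Var}(R_n)}} \leq x\right) - \Phi(x) \right| \leq \frac{C'}{\sqrt[3]{n}},$$ where $\Phi$ is the cumulative distribution function of the standard normal distribution.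
   Context: $S_n$ is the group of permutations of $\{1,\dots,n\}$. A permutation $\pi\in S_n$ has a descent at position $i$ ($1\le i\le n-1$) if $\pi(i)>\pi(i+1)$; the number of descents of $\pi$ is the number of such positions $i$. An involution is a permutation $\pi$ with $\pi^2=1$ (the identity is included). A derangement is a permutation $\pi$ with $\pi(i)\ne i$ for all $i$. *)

(* Defs.v *)
From HB Require Import structures.
From mathcomp Require Import all_boot all_order all_algebra all_fingroup.
From mathcomp Require Import all_classical all_reals all_analysis.
Set Implicit Arguments.
Unset Strict Implicit.
Unset Printing Implicit Defensive.
Import Order.TTheory GRing.Theory Num.Theory.
Import numFieldNormedType.Exports.
Local Open Scope classical_set_scope.
Local Open Scope ring_scope.

(* 'S_n permutes {0, ..., n-1}: position i of the 1-based convention is the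
   index i-1 here, and the last index never has a successor j. *)
Definition descents n (s : 'S_n) : {set 'I_n} :=
  [set i : 'I_n | [exists j : 'I_n, (val j == i.+1) && (s j < s i)%N]]%SET.

Definition involutions n : {set 'S_n} := [set s : 'S_n | (s ^+ 2 == 1)%g]%SET.

Definition derangements n : {set 'S_n} :=
  [set s : 'S_n | [forall i, s i != i]]%SET.

HB.instance Definition _ (T : finType) := isPointed.Build (perm_type T) 1%g.

HB.instance Definition _ (T : finType) :=
  @isMeasurable.Build default_measure_display (perm_type T) discrete_measurable
    discrete_measurable0 discrete_measurableC discrete_measurableU.

Lemma measurable_perm (T : finType) (B : set {perm T}) : measurable B.
Proof. by []. Qed.

(* The counting measure restricted to A and normalized; the Dirac mass is only
   the default value that mnormalize requires for the case of an empty A. *)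
Definition uniform_on (R : realType) n (A : {set 'S_n}) : probability 'S_n R :=
  mnormalize (mrestr counting (measurable_perm [set` A])) (dirac (1%g : 'S_n)).

Lemma uniform_onE (R : realType) n (A : {set 'S_n}) (B : set 'S_n) :
  A != finset.set0 ->
  uniform_on R A B = ((#|[set s in A | `[< B s >]]%SET|)%:R / (#|A|)%:R)%:E.
Proof.
move=> A0.
have countE (D : {set 'S_n}) : counting [set` D] = (#|D|%:R : R)%:E.
  rewrite /counting asboolT; last exact: finite_finset.
  congr (_%:R%:E); rewrite cardE; apply/perm_size/uniq_perm.
  - exact: finmap.fset_uniq.
  - exact: enum_uniq.
  - move=> s; rewrite in_fset_set ?mem_enum; last exact: finite_finset.
    by rewrite mem_setE.
have card0 : (#|A|%:R : R) != 0 by rewrite pnatr_eq0 cards_eq0.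
rewrite /uniform_on /= /mnormalize /= /mrestr setTI countE eqe (negbTE card0) /=.
rewrite -[RHS]/((#|_|%:R)%:E * (#|A|%:R^-1)%:E)%E -countE; congr (counting _ * _)%E.
apply/seteqP; split => s /=; rewrite inE; first by case=> /asboolP -> ->.
by case/andP => -> /asboolP.
Qed.

Definition ndescents (R : realType) n (s : 'S_n) : R := #|descents s|%:R.

Definition Phi (R : realType) (x : R) : R :=
  fine (normal_prob (0 : R) 1 `]-oo, x]).

Definition standardized_cdf (R : realType) n (P : probability 'S_n R)
    (X : 'S_n -> R) (x : R) : R :=
  fine (P [set s | (X s - fine 'E_P[X]) / Num.sqrt (fine 'V_P[X]) <= x]).

(* Main.v *)
From HB Require Import structures.
Require Import Defs.
From mathcomp Require Import all_boot all_order all_algebra all_fingroup.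
From mathcomp Require Import all_classical all_reals all_analysis.
From mathcomp Require Import ring lra zify.
From mathcomp Require polyorder polyrcf.
Import Order.TTheory GRing.Theory Num.Theory.
Import numFieldNormedType.Exports.
Set Implicit Arguments.
Unset Strict Implicit.
Unset Printing Implicit Defensive.
Local Open Scope classical_set_scope.
Local Open Scope ring_scope.

(** All counts are of D = (number of descents) + 1.  Under the uniform law on S_n the generating
    polynomial of D is Eulerian and has only real roots, so D is a sum of independent Bernoulli
    variables and Stein's method gives a Berry-Esseen bound, in particular point masses of order
    n^(-1/2).  Both families are compared with this law, with an error of the same order.

    Derangements: inclusion-exclusion over a set of k prescribed fixed points; deleting these points
    changes D by at most k and leaves a uniform permutation of the other n - k points, so the k-th
    term costs O(k^2 n^(-1/2)) / k!.

    Involutions: the sum of ['C(m + n - D, n)] over the involutions counts symmetric m x m matrices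
    over nat of entry sum n, i.e. it is the coefficient of x^n in
    (1 - x)^(-m) (1 - x^2)^(-m (m - 1) / 2), and it is a polynomial
    [sum_l g_l m^(n - 2l) / (n - 2l)!].  By Worpitzky's identity each power m^(n - 2l) is the same
    sum over S_(n - 2l), so the law of D on involutions is, up to normalisation, the Eulerian law of
    S_n plus corrections of relative size 1 / (2^l l!) that are 2l-fold differences of Eulerian laws. *)

(** The Bernoulli parameters are never located. It is enough that they lie in [0, 1], because the
    mean [(n + 1) / 2] and the variance [(n + 1) / 12] of D follow from the recurrence that inserts
    a maximal letter, and Stein's method asks for nothing else. Sums over involutions are evaluated
    only on the functions [k |-> C(m + n - k, n)]; these span all functions on the range of D and so
    determine its law. A first difference of a distribution function is a point mass, which is why
    each correction is of order n^(-1/2), up to a factor exponential in l that is absorbed by [l!].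
    The normal approximation is first obtained with the Eulerian mean and variance. The true ones
    differ from them by a bounded amount and by O(n^(1/2)) respectively, an error of the same order
    after rescaling. *)

Lemma mean_value (R : realType) (f df : R -> R) (a b : R) :
  (forall x : R, is_derive x 1 f (df x)) -> a <= b ->
  exists2 c, a <= c <= b & f b - f a = df c * (b - a).
Proof.
move=> fdf ab.
have cf : {within `[a, b], continuous f}.
  apply: continuous_subspaceT => x; apply: differentiable_continuous.
  by apply/derivable1_diffP; have [] := fdf x.
have [c + ->] := MVT_segment ab (fun x _ => fdf x) cf.
by rewrite in_itv/= => ?; exists c.
Qed.

Lemma derive_ge0_homo (R : realType) (f df : R -> R) :
  (forall x : R, is_derive x 1 f (df x)) -> (forall x, 0 <= df x) ->
  {homo f : x y / x <= y}.
Proof.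
move=> fdf df0 x y xy; have [c _ fxy] := mean_value fdf xy.
by rewrite -subr_ge0 fxy mulr_ge0 ?subr_ge0.
Qed.

(** A nondecreasing function dominates its limit at minus infinity. The limit is replaced by points
    arbitrarily far to the left where [f] is at least [- e], which is what the tail estimates
    supply. *)
Lemma ge0_of_derive_ge0 (R : realType) (f df : R -> R) :
  (forall x : R, is_derive x 1 f (df x)) -> (forall x, 0 <= df x) ->
  (forall e x, 0 < e -> exists2 y, y <= x & - e <= f y) ->
  forall x, 0 <= f x.
Proof.
move=> fdf df0 f0 x; rewrite leNgt; apply/negP => fx0.
have [|y yx fy] := f0 (- f x / 2) x; first lra.
have := derive_ge0_homo fdf df0 yx; lra.
Qed.

Lemma is_derive_mul (R : realType) (f g : R -> R) (df dg x : R) :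
  is_derive x 1 f df -> is_derive x 1 g dg ->
  is_derive x 1 (fun t => f t * g t) (f x * dg + g x * df).
Proof. by move=> ? ?; rewrite -[fun t => _]/(f * g); exact: is_deriveM. Qed.

Lemma is_derive_add (R : realType) (f g : R -> R) (df dg x : R) :
  is_derive x 1 f df -> is_derive x 1 g dg ->
  is_derive x 1 (fun t => f t + g t) (df + dg).
Proof. by move=> ? ?; rewrite -[fun t => _]/(f + g); exact: is_deriveD. Qed.

Lemma is_derive_conv (R : realType) (f : R -> R) (a b x : R) :
  is_derive x 1 f a -> a = b -> is_derive x 1 f b.
Proof. by move=> + <-. Qed.

(** * The normal distribution and the solution of Stein's equation *)

Section Gaussian.
Variable R : realType.
Implicit Types x y z w a b h e : R.

Notation phi := (normal_pdf (0 : R) 1).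
Notation Phi := (@Phi R).

Lemma phiE x : phi x = normal_peak 1 * expR (- (x ^+ 2) / 2).
Proof. by rewrite normal_pdfE ?oner_eq0// /normal_fun subr0 expr1n. Qed.

Lemma phi_gt0 x : 0 < phi x.
Proof. by rewrite phiE mulr_gt0 ?expR_gt0// normal_peak_gt0// oner_eq0. Qed.

Lemma phiN x : phi (- x) = phi x.
Proof. by rewrite !phiE sqrrN. Qed.

Lemma is_derive_phi x : is_derive x 1 phi (- x * phi x).
Proof.
rewrite (_ : phi = (normal_peak 1 : R) \*: (expR \o (fun t : R => - (2^-1 * t ^+ 2)))); last first.
  by apply/funext => t; rewrite phiE /= mulNr [_ / 2]mulrC.
apply: is_derive_eq; rewrite /= /GRing.scale/=; by field.
Qed.

Definition iphi x : R := (normal_peak 1)^-1 * expR (2^-1 * x ^+ 2).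

Lemma phi_iphi x : phi x * iphi x = 1.
Proof.
rewrite phiE /iphi mulrACA mulfV ?gt_eqF ?normal_peak_gt0 ?oner_eq0// mul1r.
by rewrite -expRD mulNr mulrC addNr expR0.
Qed.

Lemma iphi_gt0 x : 0 < iphi x.
Proof. by rewrite -(pmulr_rgt0 _ (phi_gt0 x)) phi_iphi. Qed.

Lemma iphiN x : iphi (- x) = iphi x.
Proof. by rewrite /iphi sqrrN. Qed.

Lemma is_derive_iphi x : is_derive x 1 iphi (x * iphi x).
Proof.
rewrite (_ : iphi = (normal_peak 1 : R)^-1 \*: (expR \o (fun t : R => (2^-1 * t ^+ 2)))) //.
have p0 : normal_peak 1 != 0 :> R by rewrite gt_eqF ?normal_peak_gt0 ?oner_eq0.
by apply: is_derive_eq; rewrite /= /iphi /GRing.scale/=; field; rewrite p0.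
Qed.

Lemma is_derive_Phi x : is_derive x 1 Phi (phi x).
Proof.
have x1 : x < x + 1 by rewrite ltrDl.
have intphi : lebesgue_measure.-integrable
    [set` Interval -oo%O (BRight (x + 1))] (EFin \o phi).
  by apply: (integrableS _ _ (@subsetT _ _) (integrable_normal_pdf 0 1)).
have [] := continuous_FTC1 x1 intphi (ltNyr _) _.
  exact/continuous_normal_pdf/oner_neq0.
by rewrite derive1E => D <-; exact: derivableP.
Qed.

Lemma EFin_Phi x : (Phi x)%:E = normal_prob (0 : R) 1 `]-oo, x].
Proof. by rewrite fineK// fin_num_measure. Qed.

Lemma Phi_ge0 x : 0 <= Phi x.
Proof. by rewrite fine_ge0. Qed.

Lemma Phi_le1 x : Phi x <= 1.
Proof. by rewrite -lee_fin EFin_Phi probability_le1. Qed.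

Lemma Phi_homo : {homo Phi : x y / x <= y}.
Proof. exact: derive_ge0_homo is_derive_Phi (fun x => ltW (phi_gt0 x)). Qed.

(** [Phi] is the [cdf] of the identity under the normal law. This copy carries the structure of a
    random variable, which gives access to the limits of a [cdf] at both infinities. *)
Let idTR : measurableTypeR R -> R := idfun.

#[local] HB.instance Definition _ :=
  @isMeasurableFun.Build _ _ _ _ idTR (@measurable_id _ _ setT).

Lemma cdf_PhiE : cdf (idTR : {RV (normal_prob (0 : R) 1) >-> R}) = (EFin \o Phi).
Proof. by apply/funext => x; rewrite /= EFin_Phi. Qed.

Lemma Phi_small e x : 0 < e -> exists2 y, y <= x & Phi y <= e.
Proof.
move=> e0; have := cvg_cdfNy0 (idTR : {RV (normal_prob (0 : R) 1) >-> R}).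
rewrite cdf_PhiE => /fine_cvgP[_] /cvgrPdist_le /(_ _ e0)[M [_ MP]].
exists (Num.min x (M - 1)); first by rewrite ge_min lexx.
have := MP (Num.min x (M - 1)); rewrite /= sub0r normrN.
rewrite ger0_norm ?Phi_ge0//; apply.
by rewrite gt_min gtrDl oppr_lt0 ltr01 orbT.
Qed.

Lemma Phi_big e x : 0 < e -> exists2 y, x <= y & 1 - e <= Phi y.
Proof.
move=> e0; have := cvg_cdfy1 (idTR : {RV (normal_prob (0 : R) 1) >-> R}).
rewrite cdf_PhiE => /fine_cvgP[_] /cvgrPdist_le /(_ _ e0)[M [_ MP]].
exists (Num.max x (M + 1)); first by rewrite le_max lexx.
have := MP (Num.max x (M + 1)).
rewrite lt_max ltrDl ltr01 orbT => /(_ isT) /=; rewrite ler_norml; lra.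
Qed.

(** [Phi t + Phi (- t)] is constant because [phi] is even; the two tails of [Phi] identify the
    constant as 1. *)
Lemma PhiN x : Phi (- x) = 1 - Phi x.
Proof.
pose s (t : R) := Phi t + Phi (- t).
have ds (t : R) : is_derive t 1 s 0.
  rewrite (_ : s = Phi + (Phi \o -%R)) //.
  have d1 := is_derive_Phi t; have d2 := is_derive_Phi (- t).
  apply: is_derive_eq; rewrite phiN /GRing.scale/= mulrN1; exact: subrr.
have sc t : s t = s 0.
  case: (leP 0 t) => [t0|/ltW t0].
    by have [c _ /eqP] := mean_value ds t0; rewrite mul0r subr_eq0 => /eqP.
  by have [c _ /eqP] := mean_value ds t0; rewrite mul0r subr_eq0 => /eqP.
suff s01 : s 0 = 1 by have := sc x; rewrite s01 /s; lra.
have ss e : 0 < e -> `|s 0 - 1| <= e.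
  move=> e0; have [y _ y1] := Phi_big 0 e0.
  have [u uy u1] := Phi_small (- y) e0.
  have := sc (- u); rewrite /s opprK -/(s 0) => <-.
  have : Phi y <= Phi (- u) by apply: Phi_homo; lra.
  have := Phi_le1 (- u); have := Phi_ge0 u.
  by move=> *; rewrite ler_norml; lra.
apply/eqP; rewrite -subr_eq0 -normr_le0; apply/ler_addgt0Pl => e e0.
by rewrite addr0 ss.
Qed.

Lemma exp_tail_small (k e x : R) : 0 < e ->
  exists y, [/\ y <= x, y < 0 & - e <= y * (k * expR y)].
Proof.
move=> e0.
have [y [yx y1 yk]] : exists y, [/\ y <= x, y <= -1 & 4 * `|k| / e <= - y].
  exists (- Num.max (Num.max (- x) 1) (4 * `|k| / e)).
  by rewrite lerNl opprK lerN2 !le_max !lexx !orbT.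
exists y; split => //; first lra.
(* Squaring this bound gives [expR y * (y / 2) ^+ 2 <= 1], so [- y * (|k| * expR y)] is at most
   [4 * |k| / (- y)]; the threshold imposed on [- y] makes that at most [e]. *)
have h1 : 1 - y / 2 <= expR (- y / 2) by rewrite (le_trans _ (expR_ge1Dx _))//; lra.
have h2 : expR y * (expR (- y / 2) * expR (- y / 2)) = 1.
  by rewrite -!expRD (_ : y + _ = 0) ?expR0//; field.
have Ey := expR_gt0 y.
have h3 : expR y * (y / 2) ^+ 2 <= 1.
  rewrite -[leRHS]h2 ler_wpM2l ?ltW//; move: h1; set E := expR (- y / 2) => h1.
  have : 0 <= (E + y / 2) * (E - y / 2) by apply: mulr_ge0; lra.
  by clearbody E; nra.
have h4 : 4 * `|k| <= - y * e by rewrite -ler_pdivrMr.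
have h5 : - y * (`|k| * expR y) <= e.
  have p1 : - y * expR y * (4 * `|k|) <= - y * expR y * (- y * e).
    by rewrite ler_wpM2l// mulr_ge0 ?expR_ge0//; lra.
  have p2 : expR y * (y / 2) ^+ 2 * e <= 1 * e by rewrite ler_wpM2r// ltW.
  by move: p1 p2; rewrite expr2; lra.
have h6 : - y * (k * expR y) <= - y * (`|k| * expR y).
  rewrite ler_wpM2l ?ler_wpM2r ?ler_norm ?expR_ge0//; lra.
lra.
Qed.

(** The constant comes from [- x ^+ 2 / 2 <= x + 1 / 2], a form of [0 <= (x + 1) ^+ 2]. *)
Let kexp : R := normal_peak 1 * expR 2^-1.

Let phi_le_exp x : phi x <= kexp * expR x.
Proof.
rewrite phiE /kexp -mulrA -expRD ler_wpM2l ?normal_peak_ge0// ler_expR.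
have : 0 <= (x + 1) ^+ 2 by exact: sqr_ge0.
rewrite !expr2; lra.
Qed.

Let Phi_le_exp x : Phi x <= kexp * expR x.
Proof.
pose g t := kexp * expR t + -1 * Phi t.
have dg (t : R) : is_derive t 1 g (kexp * expR t - phi t).
  refine (is_derive_conv (is_derive_add
    (is_derive_mul (is_derive_cst _ _ _) (is_derive_expR _))
    (is_derive_mul (is_derive_cst _ _ _) (is_derive_Phi _))) _).
  by rewrite !mulr0 !addr0 mulN1r.
suff : 0 <= g x by rewrite /g; lra.
apply: (ge0_of_derive_ge0 dg) => [t|e t e0]; first by rewrite subr_ge0 phi_le_exp.
have [y yt ye] := Phi_small t e0; exists y => //.
by have := le_trans (ltW (phi_gt0 y)) (phi_le_exp y); rewrite /g; lra.
Qed.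

Let id_derive (x : R) : is_derive x 1 (fun t : R => t) 1.
Proof. exact: is_derive_id. Qed.

Let one_derive (x : R) : is_derive x 1 (fun=> 1 : R) 0.
Proof. exact: is_derive_cst. Qed.

(** This function has derivative [Phi], and the function of [Phi_xphi_ge0] has derivative twice this
    one: both inequalities are obtained by integrating from minus infinity. *)
Lemma phi_xPhi_ge0 x : 0 <= phi x + x * Phi x.
Proof.
have d (t : R) : is_derive t 1 (fun t => phi t + t * Phi t) (Phi t).
  refine (is_derive_conv (is_derive_add (is_derive_phi t)
    (is_derive_mul (id_derive t) (is_derive_Phi t))) _).
  ring.
apply: (ge0_of_derive_ge0 d) => [|e t e0]; first exact: Phi_ge0.
have [y [yt y0 ye]] := exp_tail_small kexp t e0; exists y => //.
apply: (le_trans ye); apply: ler_wpDl; first exact/ltW/phi_gt0.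
by rewrite ler_wnM2l ?Phi_le_exp// ltW.
Qed.

Lemma Phi_xphi_ge0 x : 0 <= (1 + x * x) * Phi x + x * phi x.
Proof.
have d (t : R) : is_derive t 1 (fun t => (1 + t * t) * Phi t + t * phi t)
    (2 * (phi t + t * Phi t)).
  refine (is_derive_conv (is_derive_add (is_derive_mul
    (is_derive_add (one_derive t) (is_derive_mul (id_derive t) (id_derive t)))
    (is_derive_Phi t)) (is_derive_mul (id_derive t) (is_derive_phi t))) _).
  cbv beta; ring.
apply: (ge0_of_derive_ge0 d) => [t|e t e0]; first by rewrite mulr_ge0// phi_xPhi_ge0.
have [y [yt y0 ye]] := exp_tail_small kexp t e0; exists y => //.
apply: (le_trans ye); apply: ler_wpDl.
  by rewrite mulr_ge0 ?Phi_ge0// addr_ge0// -expr2 sqr_ge0.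
by rewrite ler_wnM2l ?phi_le_exp// ltW.
Qed.

(** Mills' ratio [Phi / phi] of the left tail. It solves [M' = 1 + x M], so its increments are
    controlled by the monotone function [x * mills x]. *)
Definition mills x := Phi x * iphi x.

Lemma is_derive_mills x : is_derive x 1 mills (1 + x * mills x).
Proof.
refine (is_derive_conv (is_derive_mul (is_derive_Phi x) (is_derive_iphi x)) _).
by rewrite [_ * phi x]mulrC phi_iphi /mills; ring.
Qed.

Lemma mills_ge0 x : 0 <= mills x.
Proof. by rewrite mulr_ge0 ?Phi_ge0// ltW// iphi_gt0. Qed.

Lemma mills_slope_ge0 x : 0 <= 1 + x * mills x.
Proof.
have -> : 1 + x * mills x = (phi x + x * Phi x) * iphi x.
  by rewrite mulrDl phi_iphi /mills mulrA.
by rewrite mulr_ge0 ?phi_xPhi_ge0// ltW// iphi_gt0.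
Qed.

Lemma mills_homo : {homo mills : x y / x <= y}.
Proof. exact: derive_ge0_homo is_derive_mills mills_slope_ge0. Qed.

Lemma x_mills_homo : {homo (fun x => x * mills x) : x y / x <= y}.
Proof.
have d (t : R) : is_derive t 1 (fun t => t * mills t)
    (((1 + t * t) * Phi t + t * phi t) * iphi t).
  refine (is_derive_conv (is_derive_mul (id_derive t) (is_derive_mills t)) _).
  by rewrite mulrDl -[t * phi t * _]mulrA phi_iphi /mills; ring.
apply: (derive_ge0_homo d) => t.
by rewrite mulr_ge0 ?Phi_xphi_ge0// ltW// iphi_gt0.
Qed.

Lemma mills_increment a b : a <= b ->
  (b - a) * (1 + a * mills a) <= mills b - mills a <= (b - a) * (1 + b * mills b).
Proof.
move=> ab; have [c /andP[ac cb] ->] := mean_value is_derive_mills ab.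
by rewrite ![(b - a) * _]mulrC !ler_wpM2r ?subr_ge0// lerD2l x_mills_homo.
Qed.

(* The bounded solution of Stein's equation f'(w) - w f(w) = 1_{w <= z} - Phi(z). *)
Definition stein z w := if w <= z then Phi (- z) * mills w else Phi z * mills (- w).

Lemma stein_le z w : w <= z -> stein z w = Phi (- z) * mills w.
Proof. by rewrite /stein => ->. Qed.

Lemma stein_ge z w : z <= w -> stein z w = Phi z * mills (- w).
Proof.
rewrite /stein; case: ltgtP => // -> _.
by rewrite /mills iphiN mulrCA mulrA.
Qed.

Lemma Phi_millsN w : Phi (- w) * mills w = Phi w * mills (- w).
Proof. by rewrite /mills iphiN mulrCA mulrA. Qed.

Lemma stein_bounds z w : stein z w <= mills 0 /\ `|w * stein z w| <= 1.
Proof.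
(* The case [w <= z]; the other one is this case at [(- w, - z)]. For [0 <= a],
   [Phi (- b) <= Phi (- a)] and [Phi_millsN] move the argument of [mills] to the negative side,
   where it is bounded. *)
have half a b : a <= b -> Phi (- b) * mills a <= mills 0 /\ `|a * (Phi (- b) * mills a)| <= 1.
  move=> ab; have m0 := mills_ge0 a; have P1 := Phi_le1 (- b); have P0 := Phi_ge0 (- b).
  have [a0|/ltW a0] := leP a 0.
    have ma := mills_homo a0; have ms := mills_slope_ge0 a.
    split.
      by rewrite (le_trans _ ma)// ler_piMl.
    rewrite mulrCA normrM (ger0_norm P0) mulr_ile1//.
    by rewrite ler0_norm; [lra|rewrite mulr_le0_ge0].
  have Pab : Phi (- b) * mills a <= Phi a * mills (- a).
    by rewrite -Phi_millsN ler_wpM2r// Phi_homo// lerN2.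
  have a0' : - a <= 0 by rewrite oppr_le0.
  have Pa1 := Phi_le1 a; have Pa0 := Phi_ge0 a.
  have m0' := mills_ge0 (- a).
  split.
    by rewrite (le_trans Pab)// (le_trans _ (mills_homo a0'))// ler_piMl.
  rewrite ger0_norm; last by rewrite mulr_ge0// mulr_ge0.
  apply: (le_trans (ler_wpM2l a0 Pab)).
  have am0 : 0 <= a * mills (- a) by rewrite mulr_ge0.
  have am1 : a * mills (- a) <= 1 by have := mills_slope_ge0 (- a); lra.
  by rewrite mulrCA mulr_ile1.
have [wz|zw] := leP w z; first by rewrite stein_le//; exact: half.
have wz' : - w <= - z by rewrite lerN2 ltW.
have [h1 h2] := half _ _ wz'; rewrite opprK in h1 h2.
by rewrite stein_ge ?(ltW zw)//; split => //; rewrite -normrN -mulNr.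
Qed.

(** Stein's equation gives the derivative [w f(w) + 1_{w <= z} - Phi z], which by this lemma is an
    increasing plus a decreasing function of [w]. Such a splitting is what [bern_stein] asks for,
    and no smoothing of the indicator is involved. *)
Lemma w_stein_homo z : {homo (fun w => w * stein z w) : x y / x <= y}.
Proof.
have hl x y : x <= y -> y <= z -> x * stein z x <= y * stein z y.
  move=> xy yz; rewrite !stein_le// ?(le_trans xy)//.
  by rewrite mulrCA [leRHS]mulrCA ler_wpM2l ?Phi_ge0// x_mills_homo.
have hr x y : z <= x -> x <= y -> x * stein z x <= y * stein z y.
  move=> zx xy; rewrite !stein_ge// ?(le_trans zx)//.
  rewrite mulrCA [leRHS]mulrCA ler_wpM2l ?Phi_ge0//.
  by rewrite -lerN2 -!mulNr x_mills_homo// lerN2.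
move=> x y xy; have [yz|/ltW zy] := leP y z; first exact: hl.
have [xz|/ltW zx] := leP x z; last exact: hr.
by apply: (le_trans (hl _ _ xz (lexx z))); exact: hr.
Qed.

Lemma stein_increment_le z a b : a <= b -> b <= z ->
  (b - a) * (a * stein z a + 1 - Phi z) <= stein z b - stein z a
    <= (b - a) * (b * stein z b + 1 - Phi z).
Proof.
move=> ab bz; rewrite !stein_le// ?(le_trans ab)//.
have /andP[h1 h2] := mills_increment ab.
have P0 := Phi_ge0 (- z).
have := ler_wpM2l P0 h1; have := ler_wpM2l P0 h2; rewrite !PhiN.
by move=> *; apply/andP; split; lra.
Qed.

Lemma stein_increment_ge z a b : z <= a -> a <= b ->
  (b - a) * (a * stein z a - Phi z) <= stein z b - stein z a
    <= (b - a) * (b * stein z b - Phi z).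
Proof.
move=> za ab; rewrite !stein_ge// ?(le_trans za)//.
have ab' : - b <= - a by rewrite lerN2.
have /andP[h1 h2] := mills_increment ab'.
have P0 := Phi_ge0 z.
have := ler_wpM2l P0 h1; have := ler_wpM2l P0 h2.
by move=> *; apply/andP; split; lra.
Qed.

(** The increasing part of the derivative is evaluated at one end of the step and the decreasing
    indicator at the other, so the bounds also hold across the jump at [z]. *)
Lemma stein_increment z w h : 0 <= h ->
  h * (w * stein z w + (w + h <= z)%R%:R - Phi z) <= stein z (w + h) - stein z w
    <= h * ((w + h) * stein z (w + h) + (w <= z)%R%:R - Phi z).
Proof.
move=> h0; have wh : w <= w + h by rewrite lerDl.
have hE : w + h - w = h by rewrite addrAC subrr add0r.
have [whz|/ltW zwh] := leP (w + h) z.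
  by have := stein_increment_le wh whz; rewrite hE (le_trans wh whz).
have [wz|zw] := leP w z; last first.
  by have := stein_increment_ge (ltW zw) wh; rewrite hE /= !addr0.
have /andP[l1 l2] := stein_increment_le wz (lexx z).
have /andP[r1 r2] := stein_increment_ge (lexx z) zwh.
have m1 := w_stein_homo z wz; have m2 := w_stein_homo z zwh.
have z1 : 0 <= z - w by rewrite subr_ge0.
have z2 : 0 <= w + h - z by rewrite subr_ge0.
move: (ler_wpM2l z2 m1) (ler_wpM2l z1 m2); rewrite mulr1n mulr0n => n1 n2.
by apply/andP; split; lra.
Qed.

Lemma stein_lipschitz z w h : 0 <= h -> `|stein z (w + h) - stein z w| <= 2 * h.
Proof.
move=> h0; have /andP[l u] := stein_increment z w h0.
have [_] := stein_bounds z w; have [_] := stein_bounds z (w + h).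
rewrite !ler_norml => /andP[a1 a2] /andP[b1 b2].
have P0 := Phi_ge0 z; have P1 := Phi_le1 z.
have i0 (b : bool) : 0 <= (b%:R : R) <= 1 by case: b => /=; rewrite ?lexx ?ler01.
have /andP[i1 i2] := i0 (w <= z); have /andP[j1 j2] := i0 (w + h <= z).
apply/andP; split.
  by apply: le_trans l; rewrite mulrC -mulrN ler_wpM2l//; lra.
by apply: (le_trans u); rewrite mulrC ler_wpM2r//; lra.
Qed.

Lemma phi_le1 x : phi x <= 1.
Proof.
apply: (le_trans (normal_pdf_ub _ _ _)); first exact: oner_neq0.
rewrite /normal_peak invf_le1 ?sqrtr_gt0; have := pi_ge2 R; rewrite expr1n mul1r.
  move=> ?; rewrite -[leLHS]sqrtr1 ler_sqrt; lra.
lra.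
Qed.

Lemma Phi_lipschitz x y : `|Phi x - Phi y| <= `|x - y|.
Proof.
wlog xy : x y / y <= x.
  move=> H; have [yx|/ltW xy] := leP y x; first exact: H.
  by rewrite distrC [leRHS]distrC; exact: H.
have [c _ ->] := mean_value is_derive_Phi xy.
by rewrite normrM ler_piMl// ger0_norm ?phi_le1// ltW// phi_gt0.
Qed.

Lemma x_phi_le1 x : 0 <= x -> x * phi x <= 1.
Proof.
move=> x0; have p1 : normal_peak 1 <= 1 :> R.
  by have := phi_le1 0; rewrite phiE expr0n/= oppr0 mul0r expR0 mulr1.
have E : x * expR (- (x ^+ 2) / 2) <= 1.
  rewrite mulNr expRN ler_pdivrMr ?expR_gt0// mul1r.
  apply: le_trans (expR_ge1Dx _).
  have := sqr_ge0 (x - 1); rewrite !expr2; lra.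
rewrite phiE mulrCA mulr_ile1 ?normal_peak_ge0// mulr_ge0// expR_ge0.
Qed.

(** [x phi (a x) <= 1 / a] bounds the effect of a dilation uniformly in [x >= 0]; for [a <= 1 / 2]
    the right-hand side is already at least 1. *)
Lemma Phi_scale a x : 0 <= a -> `|Phi (a * x) - Phi x| <= 2 * `|a - 1|.
Proof.
move=> a0; wlog x0 : x / 0 <= x.
  move=> H; have [/H//|/ltW x0] := leP 0 x.
  have := H (- x); rewrite oppr_ge0 => /(_ x0); rewrite mulrN !PhiN.
  rewrite (_ : 1 - _ - (1 - _) = Phi x - Phi (a * x)); last by ring.
  by rewrite distrC.
have [a2|a2] := leP a 2^-1.
  have := Phi_ge0 x; have := Phi_le1 x; have := Phi_ge0 (a * x); have := Phi_le1 (a * x).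
  rewrite [`|a - 1|]ler0_norm; last lra.
  by rewrite ler_norml => *; lra.
have key u v : 0 <= u -> u <= v -> `|Phi v - Phi u| * u <= v - u.
  move=> u0 uv; have [c /andP[uc cv] ->] := mean_value is_derive_Phi uv.
  have c0 := le_trans u0 uc.
  rewrite ger0_norm ?mulr_ge0 ?subr_ge0// ?(ltW (phi_gt0 _))//.
  rewrite mulrAC ler_piMl ?subr_ge0//.
  apply: le_trans (x_phi_le1 c0); rewrite mulrC ler_wpM2r//; exact/ltW/phi_gt0.
have [->|x0'] := eqVneq x 0; first by rewrite mulr0 subrr normr0 mulr_ge0.
have xp : 0 < x by rewrite lt_def x0' x0.
rewrite -(ler_pM2r xp) -mulrA -[X in _ <= 2 * (_ * X)](ger0_norm x0) -normrM mulrBl mul1r.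
have [a1|/ltW a1] := leP 1 a.
  have xa : x <= a * x by rewrite ler_peMl.
  apply: (le_trans (key _ _ x0 xa)); have := ler_norm (a * x - x).
  by have := normr_ge0 (a * x - x); lra.
have xa : a * x <= x by rewrite ler_piMl.
have := key _ _ (mulr_ge0 a0 x0) xa; rewrite distrC => k.
rewrite [leRHS](_ : _ = 2 * (x - a * x)); last by rewrite ler0_norm ?subr_le0// opprB.
apply: le_trans (ler_wpM2l _ k) => //.
have := mulr_ge0 (normr_ge0 (Phi (a * x) - Phi x)) x0.
by nra.
Qed.

End Gaussian.

(** * Berry-Esseen bound for sums of independent Bernoulli variables *)

Section BernoulliSum.
Variable R : realType.
Implicit Types (p : R) (ps : seq R) (f g : nat -> R).

(* Expectation of f at a sum of independent Bernoulli variables of parameters ps. *)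
Fixpoint bern ps f : R :=
  if ps is p :: ps' then (1 - p) * bern ps' f + p * bern ps' (f \o S) else f 0%N.

Lemma bernD ps f g : bern ps (fun k => f k + g k) = bern ps f + bern ps g.
Proof.
elim: ps f g => //= p ps IH f g.
by rewrite IH (IH (f \o S) (g \o S)) !mulrDr addrACA.
Qed.

Lemma bernZ ps c f : bern ps (fun k => c * f k) = c * bern ps f.
Proof.
elim: ps f => //= p ps IH f.
by rewrite IH (IH (f \o S)) mulrDr; congr (_ + _); exact: mulrCA.
Qed.

Lemma bern_cst ps c : bern ps (fun=> c) = c.
Proof.
elim: ps => //= p ps IH; have -> : (fun=> c) \o S = (fun=> c) :> (nat -> R) by [].
by rewrite IH; ring.
Qed.

Definition in01 : pred R := fun p => 0 <= p <= 1.

Lemma bern_le ps f g : all in01 ps -> (forall k, f k <= g k) -> bern ps f <= bern ps g.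
Proof.
elim: ps f g => //= p ps IH f g /andP[/andP[p0 p1] ps01] fg.
by rewrite lerD// ler_wpM2l ?subr_ge0// IH// => k; exact: fg.
Qed.

Definition bern_mean ps := \sum_(p <- ps) p.
Definition bern_var ps := \sum_(p <- ps) p * (1 - p).

(** A one-sided Stein inequality, by conditioning on one variable of parameter [p]. Its centred
    contribution is [p (1 - p)] times the mean of [f k.+1 - f k] at the sum [k] of the others. The
    full sum is [k] or [k + 1], so monotonicity turns [a k] and [b k.+1] into bounds at the full
    sum. *)
Lemma bern_stein ps f (a b : nat -> R) : all in01 ps ->
  (forall k, f k.+1 - f k <= a k + b k.+1) ->
  (forall k, a k <= a k.+1) -> (forall k, b k.+1 <= b k) ->
  bern ps (fun k => (k%:R - bern_mean ps) * f k)
    <= bern_var ps * bern ps (fun k => a k + b k).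
Proof.
elim: ps f a b => [f a b _ _ _ _|p ps IH f a b /=].
  by rewrite /bern_mean /bern_var/= !big_nil subrr !mul0r.
move=> /andP[/andP[p0 p1] ps01] fab aa bb.
have q0 : 0 <= 1 - p by rewrite subr_ge0.
rewrite /bern_mean /bern_var !big_cons -/(bern_mean ps) -/(bern_var ps).
have -> : bern ps (fun k => (k%:R - (p + bern_mean ps)) * f k) =
    bern ps (fun k => (k%:R - bern_mean ps) * f k) - p * bern ps f.
  rewrite -mulNr -bernZ -bernD; congr bern; apply/funext => k; ring.
have -> : bern ps ((fun k => (k%:R - (p + bern_mean ps)) * f k) \o S) =
    bern ps (fun k => (k%:R - bern_mean ps) * (f \o S) k) + (1 - p) * bern ps (f \o S).
  rewrite -bernZ -bernD; congr bern; apply/funext => k /=.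
  by rewrite -[k.+1%:R]natr1; ring.
have h1 := IH f a b ps01 fab aa bb.
have h2 := IH (f \o S) (a \o S) (b \o S) ps01 (fun k => fab k.+1)
  (fun k => aa k.+1) (fun k => bb k.+1).
have h3 : bern ps (f \o S) - bern ps f <= bern ps (fun k => a k + b k.+1).
  by rewrite -mulN1r -bernZ -bernD; apply: bern_le => // k; rewrite mulN1r; exact: fab.
have h4 : bern ps (fun k => a k + b k.+1) <=
    (1 - p) * bern ps (fun k => a k + b k) + p * bern ps ((fun k => a k + b k) \o S).
  rewrite -!bernZ -bernD; apply: bern_le => // k /=.
  have := ler_wpM2l p0 (aa k); have := ler_wpM2l q0 (bb k); lra.
have := ler_wpM2l q0 h1; have := ler_wpM2l p0 h2.
have h5 := le_trans h3 h4.
have := ler_wpM2l (mulr_ge0 p0 q0) h5.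
move: (bern ps _) (bern ps _) (bern ps _) (bern ps _) (bern ps _) (bern ps _) => *; lra.
Qed.

Lemma bern_centered ps : all in01 ps -> bern ps (fun k => k%:R - bern_mean ps) = 0.
Proof.
move=> ps01; apply/le_anti/andP; split.
  have := @bern_stein ps (fun=> 1) (fun=> 0) (fun=> 0) ps01.
  rewrite addr0 bern_cst mulr0 subrr.
  have -> : (fun k => (k%:R - bern_mean ps) * 1) = (fun k => k%:R - bern_mean ps).
    by apply/funext => k; rewrite mulr1.
  by apply.
have := @bern_stein ps (fun=> -1) (fun=> 0) (fun=> 0) ps01.
rewrite addr0 bern_cst mulr0 subrr.
have -> : (fun k => (k%:R - bern_mean ps) * -1) = (fun k => -1 * (k%:R - bern_mean ps)).
  by apply/funext => k; rewrite mulrC.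
by rewrite bernZ mulN1r oppr_le0; apply.
Qed.

Lemma bern_second_moment ps : all in01 ps ->
  bern ps (fun k => (k%:R - bern_mean ps) ^+ 2) = bern_var ps.
Proof.
move=> ps01; apply/le_anti/andP; split.
  have := @bern_stein ps (fun k => k%:R - bern_mean ps) (fun=> 1) (fun=> 0) ps01.
  rewrite addr0 bern_cst mulr1; apply => // k; rewrite -[k.+1%:R]natr1; lra.
have : bern ps (fun k => (k%:R - bern_mean ps) * - (k%:R - bern_mean ps))
    <= bern_var ps * bern ps (fun k => -1 + 0).
  apply: (@bern_stein ps _ (fun=> -1) (fun=> 0)) => // k.
  rewrite -[k.+1%:R]natr1; lra.
rewrite addr0 bern_cst mulrN1 (_ : (fun k => _) =
  (fun k => -1 * (k%:R - bern_mean ps) ^+ 2)); last by apply/funext => k; ring.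
by rewrite bernZ mulN1r lerN2.
Qed.

Theorem bern_berry_esseen ps (y : R) : all in01 ps -> 0 < bern_var ps ->
  `|bern ps (fun k => (k%:R <= y)%R%:R)
      - Phi ((y - bern_mean ps) / Num.sqrt (bern_var ps))|
    <= (mills 0 + 3) / Num.sqrt (bern_var ps).
Proof.
move=> ps01 v0; set s := Num.sqrt _.
have s0 : 0 < s by rewrite sqrtr_gt0.
have ss : s * s = bern_var ps by rewrite -expr2 sqr_sqrtr// ltW.
have [h [h0 sh hE]] : exists h, [/\ 0 < h, s * h = 1 & s^-1 = h].
  by exists s^-1; rewrite invr_gt0 mulfV ?gt_eqF.
pose W k : R := (k%:R - bern_mean ps) * h.
have WS k : W k.+1 = W k + h by rewrite /W -[k.+1%:R]natr1; ring.
have EW2 : bern ps (fun k => W k ^+ 2) <= 1.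
  have -> : (fun k => W k ^+ 2) = (fun k => h ^+ 2 * (k%:R - bern_mean ps) ^+ 2).
    by apply/funext => k; rewrite /W exprMn mulrC.
  rewrite bernZ bern_second_moment//.
  by rewrite -ss -expr2 -exprMn [h * s]mulrC sh expr1n.
have sW k : k%:R - bern_mean ps = s * W k.
  by rewrite /W mulrCA sh mulr1.
pose m0 : R := mills 0.
(* [w |-> w f(w)] moves by at most [h (m0 + 2 |w|)] over a step [h], and [2 E|W| <= E(1 + W^2)] *)
have remainder (u : nat -> R) : (forall k, u k <= h * m0 + h * (2 * `|W k|)) ->
    bern ps u <= h * (m0 + 2).
  move=> ub; apply: (@le_trans _ _ (bern ps (fun k => h * (m0 + 1) + h * W k ^+ 2))).
    apply: bern_le => // k; apply: (le_trans (ub k)).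
    rewrite -!mulrDr ler_wpM2l ?(ltW h0)//.
    by have := sqr_ge0 (`|W k| - 1); rewrite sqrrB1 real_normK ?num_real// -mulr_natl; lra.
  rewrite bernD bern_cst bernZ.
  have := ler_wpM2l (ltW h0) EW2; lra.
have lip z w (t : R) : t * (stein z (w + h) - stein z w) <= h * (2 * `|t|).
  apply: (le_trans (ler_norm _)); rewrite normrM [leRHS]mulrCA mulrCA.
  rewrite [leRHS](_ : _ = `|t| * (2 * h)); last by ring.
  by rewrite ler_wpM2l// stein_lipschitz// ltW.
(* The upper half of [stein_increment] in [bern_stein]: [a] carries [w f(w)] at [W k + h], and
   [b k.+1] is the indicator at [W k], which shifts [z] by one step [h]. *)
have up z : Phi z - h * (m0 + 2) <= bern ps (fun k => (W k <= z + h)%R%:R).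
  have st : bern ps (fun k => (k%:R - bern_mean ps) * stein z (W k))
      <= bern_var ps * bern ps (fun k =>
        h * ((W k + h) * stein z (W k + h) - Phi z) + h * (W k <= z + h)%R%:R).
    apply: bern_stein => // k.
    - rewrite WS; have /andP[_] := stein_increment z (W k) (ltW h0).
      by rewrite lerD2r -mulrDr addrAC.
    - by rewrite ler_wpM2l ?(ltW h0)// lerB// w_stein_homo// WS !lerD2r lerDl ltW.
    - rewrite ler_wpM2l ?(ltW h0)// WS lerD2r ler_nat.
      by case: leP => //= Wz; rewrite (le_trans Wz)// lerDl ltW.
  have rem := remainder (fun k => (W k + h) * stein z (W k + h) + -1 * (W k * stein z (W k))) _.
  have {}rem : bern ps (fun k => (W k + h) * stein z (W k + h)) -
      bern ps (fun k => W k * stein z (W k)) <= h * (m0 + 2).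
    rewrite -mulN1r -bernZ -bernD; apply: rem => k.
    have [sm _] := stein_bounds z (W k + h).
    have := ler_wpM2l (ltW h0) sm; have := lip z (W k) (W k); rewrite -/m0; lra.
  have E1 : bern ps (fun k => (k%:R - bern_mean ps) * stein z (W k)) =
      s * bern ps (fun k => W k * stein z (W k)).
    by rewrite -bernZ; congr bern; apply/funext => k; rewrite sW mulrA.
  have E2 : bern ps (fun k =>
      h * ((W k + h) * stein z (W k + h) - Phi z) + h * (W k <= z + h)%R%:R) =
    h * (bern ps (fun k => (W k + h) * stein z (W k + h)) - Phi z
        + bern ps (fun k => (W k <= z + h)%R%:R)).
    rewrite -(bern_cst ps (Phi z)) -mulN1r -bernZ -!bernD -bernZ.
    by congr bern; apply/funext => k; rewrite bern_cst; ring.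
  move: st; rewrite E1 E2 -ss -mulrA ler_pM2l// mulrA sh mul1r; lra.
(* The lower half, applied to [- stein z]: now the negated indicator is the increasing function [a],
   and [- w f(w)] goes into [b]. *)
have lo z : bern ps (fun k => (W k + h <= z)%R%:R) <= Phi z + h * (m0 + 2).
  have st : bern ps (fun k => (k%:R - bern_mean ps) * (- stein z (W k)))
      <= bern_var ps * bern ps (fun k =>
        - h * (W k + h <= z)%R%:R + - h * ((W k - h) * stein z (W k - h) - Phi z)).
    apply: bern_stein => // k.
    - rewrite WS addrK; have /andP[+ _] := stein_increment z (W k) (ltW h0).
      lra.
    - rewrite !mulNr lerN2 ler_wpM2l ?(ltW h0)// WS ler_nat.
      by case: (leP (W k + h + h)) => //= Wz; rewrite (le_trans _ Wz)// lerDl ltW.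
    - rewrite WS addrK !mulNr lerN2 ler_wpM2l ?(ltW h0)// lerB// w_stein_homo//.
      by rewrite gerBl ltW.
  have rem := remainder (fun k => W k * stein z (W k) + -1 * ((W k - h) * stein z (W k - h))) _.
  have {}rem : bern ps (fun k => W k * stein z (W k)) -
      bern ps (fun k => (W k - h) * stein z (W k - h)) <= h * (m0 + 2).
    rewrite -mulN1r -bernZ -bernD; apply: rem => k.
    have [sm _] := stein_bounds z (W k - h).
    have := ler_wpM2l (ltW h0) sm; have := lip z (W k - h) (W k); rewrite subrK -/m0; lra.
  have E1 : bern ps (fun k => (k%:R - bern_mean ps) * (- stein z (W k))) =
      s * (-1 * bern ps (fun k => W k * stein z (W k))).
    by rewrite -!bernZ; congr bern; apply/funext => k; rewrite sW; ring.
  have E2 : bern ps (fun k =>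
      - h * (W k + h <= z)%R%:R + - h * ((W k - h) * stein z (W k - h) - Phi z)) =
    h * (Phi z + -1 * bern ps (fun k => (W k + h <= z)%R%:R)
        + -1 * bern ps (fun k => (W k - h) * stein z (W k - h))).
    rewrite -(bern_cst ps (Phi z)) -!bernZ -!bernD -bernZ.
    by congr bern; apply/funext => k; rewrite bern_cst; ring.
  move: st; rewrite E1 E2 -ss -mulrA ler_pM2l// mulrA sh mul1r; lra.
have yW z k : (W k <= (y - bern_mean ps) / s + z) = (k%:R <= y + z * s).
  rewrite /W hE -(ler_pM2r s0) [(_ * h + z) * s]mulrDl -!mulrA [h * s]mulrC sh !mulr1.
  by rewrite addrAC lerD2r.
set z0 := (y - bern_mean ps) / s.
have -> : (fun k => (k%:R <= y)%R%:R) = (fun k => (W k <= z0 - h + h)%R%:R) :> (nat -> R).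
  by apply/funext => k; rewrite subrK -[z0]addr0 yW mul0r addr0.
(* Undoing the shift by [h] with [Phi_lipschitz] adds one [h] to [h * (m0 + 2)]: hence
   [mills 0 + 3]. *)
have := up (z0 - h).
have -> : bern ps (fun k => (W k <= z0 - h + h)%R%:R) = bern ps (fun k => (W k + h <= z0 + h)%R%:R).
  by congr bern; apply/funext => k; rewrite subrK lerD2r.
have := lo (z0 + h).
have := Phi_lipschitz z0 (z0 - h); have := Phi_lipschitz (z0 + h) z0.
rewrite opprB addrCA subrr addr0 [z0 + h - z0]addrAC subrr add0r (gtr0_norm h0).
rewrite !ler_norml -/m0 => /andP[_ ?] /andP[_ ?] ? ?.
by rewrite hE [_ * h]mulrC; apply/andP; split; lra.
Qed.

End BernoulliSum.

(** * Descents of words and the Eulerian recurrence *)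

Lemma sum_lift_perm (V : nmodType) n (j : 'I_n.+1) (F : 'S_n.+1 -> V) :
  \sum_(s : 'S_n.+1) F s = \sum_(i < n.+1) \sum_(s : 'S_n) F (lift_perm i j s).
Proof.
pose g (u : 'I_n.+1 * 'S_n) := lift_perm u.1 j u.2.
have g_inj : injective g.
  move=> [i s] [i' s'] /= gE.
  have ii : i = i' by apply: (@perm_inj _ (g (i, s))); rewrite {2}gE !lift_perm_id.
  rewrite -{i'}ii in gE *; congr (_, _); apply/permP => k; apply: (@lift_inj _ j).
  by rewrite -!(lift_perm_lift i) -[lift_perm _ _ s]/(g (i, s)) gE.
have g_bij : bijective g.
  by apply: inj_card_bij => //; rewrite card_prod !card_Sn card_ord factS.
rewrite pair_bigA /= (reindex g) //=.
by case: g_bij => g' gK g'K; exists g' => u _.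
Qed.

Fixpoint desw (w : seq nat) : nat :=
  if w is x :: w' then (if w' is y :: _ then (y < x)%N + desw w' else 0) else 0.

Lemma desw_cons2 x y w : desw [:: x, y & w] = ((y < x)%N + desw (y :: w))%N.
Proof. by []. Qed.

Lemma desw_map (f : nat -> nat) w : {mono f : x y / (x < y)%N} ->
  desw (map f w) = desw w.
Proof. by move=> fm; elim: w => [|x [|y w] IH] //=; rewrite fm; congr (_ + _)%N. Qed.

Lemma desw_le_size w : (desw w <= (size w).-1)%N.
Proof.
elim: w => [|x [|y w] IH] //; rewrite desw_cons2 /=.
by rewrite (leq_add (leq_b1 _) IH).
Qed.

Definition insertw (i m : nat) (w : seq nat) := take i w ++ m :: drop i w.

Lemma desw_insertw i m w : (desw w <= desw (insertw i m w) <= (desw w).+1)%N.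
Proof.
rewrite /insertw; elim: w i => [|x w IH] [|i] //.
- by rewrite take0 drop0 cat0s desw_cons2; case: (x < m)%N; lia.
- rewrite /= -/(desw (x :: w)) -/(desw (x :: _)).
  have := IH i; case: w {IH} => [|y w].
    by case: i => [|i] /=; case: (m < x)%N.
  case: i => [|i].
    rewrite take0 drop0 cat0s !desw_cons2.
    by case: (ltnP x m); case: (ltnP m x); case: (ltnP y m); case: (ltnP y x); lia.
  by rewrite /= -!/(desw (y :: _)); lia.
Qed.

(** A new maximum creates no descent at the end or in one of the [desw w] descent gaps, and exactly
    one in every other gap. *)
Lemma sum_desw_insertw (R : comPzRingType) (M : nat) (w : seq nat) (f : nat -> R) :
  all (ltn^~ M) w ->
  \sum_(i < (size w).+1) f (desw (insertw i M w)) =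
    (desw w).+1%:R * f (desw w) + ((size w)%:R - (desw w)%:R) * f (desw w).+1.
Proof.
rewrite /insertw; elim: w f => [|x w IH] f.
  by move=> _; rewrite big_ord_recl big_ord0 /=; ring.
case: w IH => [|y w] IH; rewrite [all _ _]/= => /andP[xM wM].
  by rewrite !big_ord_recl big_ord0 /= xM ltnNge (ltnW xM) /=; ring.
have yM : (y < M)%N by case/andP: wM.
(* Inserting into [[:: x, y & w]] at a position from 2 on is inserting into [y :: w] one position
   earlier, with [e] descents added; only the first two positions are computed directly. *)
set d := desw (y :: w); set e : nat := (y < x)%N.
have := IH (fun k => f (e + k)%N) wM; rewrite -/d.
pose G w' k := desw (take k w' ++ M :: drop k w').
rewrite -[in X in _ -> X](big_mkord xpredT (fun k => f (G [:: x, y & w] k))).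
rewrite -[in X in X -> _](big_mkord xpredT (fun k => f (e + G (y :: w) k)%N)).
rewrite desw_cons2 -/d -/e !big_nat_recl//.
have -> : G (y :: w) 0 = d.+1 by rewrite /G take0 drop0 cat0s desw_cons2 yM.
have -> : G [:: x, y & w] 0 = (e + d).+1 by rewrite /G take0 drop0 cat0s !desw_cons2 xM.
have -> : G [:: x, y & w] 1 = d.+1.
  by rewrite /G /= -/(desw (y :: w)) ltnNge (ltnW xM) yM.
set A := _ + \sum_(0 <= i < _) _ => H.
have {H} -> : A = d.+1%:R * f (e + d)%N
    + ((size (y :: w))%:R - d%:R) * f (e + d.+1)%N - f (e + d.+1)%N.
  by rewrite -H addrAC subrr add0r.
rewrite /=; move: (size w) => k; clearbody d.
rewrite /e; case: (y < x)%N; rewrite /= ?add0n ?add1n -?[k.+2%:R]natr1.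
  rewrite -[d.+2%:R]natr1 -[d.+1%:R]natr1; ring.
rewrite -[d.+1%:R]natr1; ring.
Qed.

Section Words.
Variable n : nat.
Implicit Types s : 'S_n.

Definition word s : seq nat := [seq val (s i) | i <- enum 'I_n].

Lemma size_word s : size (word s) = n.
Proof. by rewrite size_map size_enum_ord. Qed.

Lemma nth_word s (i : 'I_n) : nth 0%N (word s) i = s i.
Proof. by rewrite (nth_map i) ?size_enum_ord// nth_ord_enum. Qed.

Lemma word_lt s : all (ltn^~ n) (word s).
Proof. by apply/allP => _ /mapP[i _ ->] /=. Qed.

End Words.

Lemma desw_sum w :
  desw w = (\sum_(i < (size w).-1) (nth 0 w i.+1 < nth 0 w i))%N.
Proof.
elim: w => [|x [|y w] IH]; rewrite ?big_ord0//.
by rewrite desw_cons2 IH /= big_ord_recl.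
Qed.

Lemma card_descents n (s : 'S_n) : #|descents s| = desw (word s).
Proof.
rewrite desw_sum size_word -sum1_card; case: n s => [|n] s.
  by rewrite big_ord0 big1// => -[].
rewrite [in RHS]/= big_mkcond big_ord_recr /= inE.
rewrite [X in (_ + X)%N](_ : _ = 0)%N ?addn0; last first.
  case: existsP => // -[j /andP[/eqP jn _]].
  by have := ltn_ord j; rewrite /= in jn; rewrite jn ltnn.
apply: eq_bigr => i _; rewrite inE.
have i1 : (i.+1 < n.+1)%N by rewrite ltnS.
rewrite (nth_word s (Ordinal i1)) (nth_word s (widen_ord (leqnSn n) i)).
case: existsP => [[j /andP[/eqP ji sji]]|H].
  by have -> : Ordinal i1 = j; [exact: val_inj|rewrite sji].
case: ltnP => // sji; case: H; exists (Ordinal i1).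
by rewrite eqxx.
Qed.

Lemma word_lift_perm n (i j : 'I_n.+1) (s : 'S_n) :
  word (lift_perm i j s) = insertw i j (map (bump j) (word s)).
Proof.
have sz : size (insertw i j (map (bump j) (word s))) = n.+1.
  rewrite size_cat /= size_take size_drop size_map size_word.
  have := ltn_ord i; case: (ltnP i n); lia.
apply: (@eq_from_nth _ 0%N); rewrite size_word ?sz// => k kn.
rewrite (nth_word _ (Ordinal kn)) /insertw nth_cat size_take size_map size_word.
have -> : (if (i < n)%N then val i else n) = i.
  by case: (ltnP i n) => // ni; apply/eqP; rewrite eqn_leq ni -ltnS ltn_ord.
case: (unliftP i (Ordinal kn)) => [k' kE|kE]; last first.
  have ki : k = i by rewrite -kE.
  by rewrite kE lift_perm_id ki ltnn subnn.
have {}kE' : k = bump i k' by have := congr1 val kE.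
rewrite kE lift_perm_lift /= kE' /bump.
case: (leqP i k') => ik.
  rewrite add1n ltnNge (leq_trans ik)//= subSn//= nth_drop.
  by rewrite (nth_map 0%N) ?size_word ?subnKC// nth_word.
by rewrite add0n ik nth_take// (nth_map 0%N) ?size_word// nth_word.
Qed.

Lemma desw_lift_perm n (i j : 'I_n.+1) (s : 'S_n) :
  (#|descents s| <= #|descents (lift_perm i j s)| <= #|descents s|.+1)%N.
Proof.
rewrite !card_descents word_lift_perm.
have <- : desw (map (bump j) (word s)) = desw (word s).
  by apply: desw_map => x y; rewrite ltnNge leq_bump2 -ltnNge.
exact: desw_insertw.
Qed.

Definition sum_des (R : pzSemiRingType) n (f : nat -> R) : R :=
  \sum_(s : 'S_n) f #|descents s|.+1.

Lemma sum_des_recr (R : comPzRingType) n (f : nat -> R) :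
  sum_des n.+1 f = sum_des n (fun d => d%:R * f d + (n.+1%:R - d%:R) * f d.+1).
Proof.
rewrite /sum_des (sum_lift_perm ord_max) exchange_big; apply: eq_bigr => s _ /=.
under eq_bigr => i _ do rewrite card_descents word_lift_perm.
rewrite card_descents; set w := map _ _.
have wE : w = word s.
  rewrite /w -[RHS]map_id; apply/eq_in_map => x /(allP (word_lt s)) /= xn.
  by rewrite /bump leqNgt xn.
rewrite wE; have := sum_desw_insertw (fun k => f k.+1) (word_lt s).
rewrite size_word => -> ; rewrite -[n.+1%:R]natr1 -[(desw _).+1%:R]natr1; ring.
Qed.

(** * Real roots of the Eulerian polynomials, by Rolle's theorem *)

Section RealRooted.
Variable R : realType.
Implicit Types (p P Q : {poly R}) (f g : nat -> R).

Lemma rolle_roots p (x : R) (s : seq R) : path <%R x s -> all (root p) (x :: s) ->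
  exists r, [/\ size r = size s, all (root p^`()) r, path <%R x r &
    all (< last x s) r].
Proof.
elim: s x => [|y s IH] x /=; first by exists [::].
move=> /andP[xy ys] /andP[px /andP[py ps]].
have [c] := polyrcf.poly_rolle xy (etrans (rootP px) (esym (rootP py))).
rewrite in_itv/= => /andP[xc cy] p'c.
have [|r [sr rr yr rl]] := IH y ys; first by rewrite /= py.
exists (c :: r); rewrite /= sr rr xc rl /= (rootE p^`()) p'c eqxx; split => //.
  by case: r yr {sr rr rl} => //= z r /andP[yz ->]; rewrite (lt_trans cy yz).
rewrite andbT (lt_le_trans cy)//; elim: s y ys {IH py ps xy cy sr rr yr rl} => //= z s IH y.
by move=> /andP[yz zs]; rewrite (le_trans (ltW yz))// IH.
Qed.

(* [hpoly k] is the image of the Eulerian polynomial of [S_(k+1)] under the substitution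
   [t = 1 - 1/s]: the operator [t d/dt] becomes [s (s - 1) d/ds]. *)
Fixpoint hpoly (k : nat) : {poly R} :=
  if k is k'.+1 then 'X * ('X - 1) * (hpoly k')^`() else 'X * ('X - 1).

Lemma size_hpoly k : size (hpoly k) = k.+3.
Proof.
have s2 : size ('X * ('X - 1) : {poly R}) = 3%N.
  by rewrite mulrC size_mulX ?size_XsubC// polyXsubC_eq0.
have m2 : ('X * ('X - 1) : {poly R}) \is monic.
  by rewrite monicMl ?monicX// monicXsubC.
elim: k => [//|k IH]; rewrite /= size_monicM ?s2 ?polyorder.size_deriv ?IH//.
by rewrite -size_poly_eq0 polyorder.size_deriv IH.
Qed.

(** Rolle's theorem puts one root of the derivative in each of the [k + 1] gaps, and the factor
    [X (X - 1)] restores the end roots 0 and 1. *)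
Lemma hpoly_roots k : exists r, [/\ size r = k, path <%R 0 (rcons r 1) &
  all (root (hpoly k)) (0 :: rcons r 1)].
Proof.
have X0 P : root ('X * ('X - 1) * P) 0 by rewrite !rootM rootX eqxx.
have X1 P : root ('X * ('X - 1) * P) 1.
  by rewrite rootE !hornerM [('X - 1).[1]](_ : _ = 0) ?mulr0 ?mul0r// !hornerE subrr.
elim: k => [|k [r [sr pr rr]]].
  exists [::]; split => //; first by rewrite /= ltr01.
  by have := X0 1; have := X1 1; rewrite !mulr1 /= => -> ->.
have [q [sq rq pq ql]] := rolle_roots pr rr.
rewrite size_rcons sr in sq; rewrite last_rcons in ql.
exists q; split => //.
  rewrite rcons_path pq /=; case: q sq ql {rq pq} => //= x q _ /andP[x1 q1].
  by elim: q x x1 q1 => //= y q IH x _ /andP[]; exact: IH.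
rewrite /= X0 all_rcons X1 /=; apply: sub_all rq => z.
by rewrite rootM => ->; rewrite orbT.
Qed.

(** The polynomial [(1 - X)^N P(1 / (1 - X))]: the substitution [s = 1 / (1 - t)] cleared of
    denominators. *)
Definition hom N P : {poly R} := \sum_(j < N.+1) P`_j *: (1 - 'X) ^+ (N - j).

(** For [N = n + 1] the right-hand side is the recurrence [A_(n+1) = (n + 1) t A_n + t (1 - t) A_n']
    of the Eulerian polynomials. *)
Lemma hom_deriv N P : (size P <= N.+1)%N ->
  hom N.+1 ('X * ('X - 1) * P^`()) =
    N%:R * ('X * hom N P) + 'X * (1 - 'X) * (hom N P)^`().
Proof.
move=> sP; pose D := 'X * P^`().
have cD j : D`_j = P`_j *+ j.
  by rewrite coefXM coef_deriv; case: j => [|j] //=; rewrite mulr0n.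
have -> : 'X * ('X - 1) * P^`() = 'X * D - D by rewrite /D; ring.
rewrite /hom.
under eq_bigr => j _ do rewrite coefB scalerBl.
rewrite sumrB big_ord_recl [in X in _ - X]big_ord_recr /= coefXM /= scale0r add0r.
rewrite cD nth_default// mul0rn scale0r addr0 -sumrB.
rewrite raddf_sum !mulr_sumr -big_split /=; apply: eq_bigr => j _.
rewrite /bump /= add1n coefXM /= cD subSS subSn ?leq_ord//.
rewrite derivZ deriv_exp derivB derivX -polyC1 derivC sub0r polyC1.
rewrite -!mul_polyC polyCMn exprS.
have -> : N%:R = ((N - j) + j)%:R :> {poly R} by rewrite subnK ?leq_ord.
rewrite natrD -[_ *+ j]mulr_natr -[_ *+ (N - j)]mulr_natr.
case: (N - j)%N => [|m] /=; first by rewrite !mulr0n; ring.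
by rewrite exprS; ring.
Qed.

Lemma hom_mulXsubC N P (z : R) : (size P <= N.+1)%N ->
  hom N.+1 (('X - z%:P) * P) = (1 - z%:P * (1 - 'X)) * hom N P.
Proof.
move=> sP; rewrite mulrBl /hom.
under eq_bigr => j _ do rewrite coefB scalerBl coefCM.
rewrite sumrB big_ord_recl [in X in _ - X]big_ord_recr /= coefXM /= scale0r add0r.
rewrite nth_default// mulr0 scale0r addr0 -sumrB mulr_sumr; apply: eq_bigr => j _.
rewrite /bump /= add1n coefXM /= subSS subSn ?leq_ord// exprS.
by rewrite -!mul_polyC polyCM; ring.
Qed.

(** A root [z] becomes the factor [(1 - z) + z X], the generating function of a Bernoulli variable
    of parameter [z]: the roots of [hpoly] are the parameters. *)
Lemma hom_prod (r : seq R) :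
  hom (size r) (\prod_(z <- r) ('X - z%:P)) = \prod_(z <- r) (1 - z%:P * (1 - 'X)).
Proof.
elim: r => [|z r IH] /=.
  by rewrite !big_nil /hom big_ord1 coef1 /= expr0 scale1r.
by rewrite !big_cons hom_mulXsubC ?IH// size_prod_XsubC.
Qed.

Lemma homZ N (c : R) P : hom N (c *: P) = c *: hom N P.
Proof. by rewrite /hom scaler_sumr; apply: eq_bigr => j _; rewrite coefZ scalerA. Qed.

Lemma sum_des0 (S : pzSemiRingType) (f : nat -> S) : sum_des 0 f = f 1%N.
Proof.
rewrite /sum_des (eq_bigr (fun=> f 1%N)) => [|s _].
  by rewrite sumr_const card_Sn.
by rewrite eq_card0// => -[].
Qed.

Lemma sum_des_hom k : sum_des k.+1 (fun d => 'X^d : {poly R}) = hom k.+2 (hpoly k).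
Proof.
elim: k => [|k IH].
  rewrite sum_des_recr sum_des0 /hom /= !big_ord_recl big_ord0 /= /bump /=.
  rewrite !coefXM /= !coefB !coefX !coef1 /= scale0r sub0r subr0 scaleN1r scale1r; ring.
rewrite [hpoly _]/= hom_deriv ?size_hpoly// -IH sum_des_recr /sum_des.
rewrite raddf_sum !mulr_sumr -big_split /=; apply: eq_bigr => s _.
by rewrite derivXn /= -mulr_natr !exprS; ring.
Qed.

(** The linear functional [X^k |-> f k]; on a probability generating polynomial it is the
    expectation of [f]. *)
Definition ev P f : R := \sum_(k < size P) P`_k * f k.

Lemma ev_widen N P f : (size P <= N)%N -> ev P f = \sum_(k < N) P`_k * f k.
Proof.
move=> sP; rewrite /ev (big_ord_widen N (fun k => P`_k * f k) sP) big_mkcond.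
by apply: eq_bigr => k _; case: ltnP => // /(nth_default 0) ->; rewrite mul0r.
Qed.

Lemma evD P Q f : ev (P + Q) f = ev P f + ev Q f.
Proof.
pose N := maxn (size P) (size Q).
rewrite !(@ev_widen N) ?leq_maxl ?leq_maxr ?size_polyD// -big_split /=.
by apply: eq_bigr => k _; rewrite coefD mulrDl.
Qed.

Lemma evZ (c : R) P f : ev (c *: P) f = c * ev P f.
Proof.
rewrite (ev_widen _ (size_scale_leq c P)) /ev mulr_sumr.
by apply: eq_bigr => k _; rewrite coefZ mulrA.
Qed.

Lemma evMX P f : ev ('X * P) f = ev P (f \o S).
Proof.
rewrite (@ev_widen (size P).+1) ?big_ord_recl ?coefXM/= ?mul0r ?add0r.
  by apply: eq_bigr => k _; rewrite /bump coefXM.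
by have := size_polyMleq 'X P; rewrite size_polyX.
Qed.

Lemma ev1 f : ev 1 f = f 0%N.
Proof. by rewrite /ev size_poly1 big_ord1 coef1 mul1r. Qed.

Lemma evXn d f : ev 'X^d f = f d.
Proof.
elim: d f => [|d IH] f; first by rewrite expr0 ev1.
by rewrite exprS evMX IH.
Qed.

Lemma ev_prod (r : seq R) f : ev (\prod_(z <- r) (1 - z%:P * (1 - 'X))) f = bern r f.
Proof.
elim: r f => [|z r IH] f; first by rewrite big_nil ev1.
rewrite big_cons; set P := \prod_(_ <- _) _.
have -> : (1 - z%:P * (1 - 'X)) * P = (1 - z) *: P + z *: ('X * P).
  by rewrite -!mul_polyC polyCB; ring.
by rewrite evD !evZ evMX !IH.
Qed.

Lemma ev_sum_des n f : ev (sum_des n (fun d => 'X^d)) f = sum_des n f.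
Proof.
rewrite /sum_des; elim/big_rec2: _ => [|s x P _ <-]; last by rewrite evD evXn.
by rewrite /ev size_poly0 big_ord0.
Qed.

Lemma sum_des_bern n : (0 < n)%N ->
  exists2 ps : seq R, all (@in01 R) ps & forall f, sum_des n f = n`!%:R * bern ps f.
Proof.
case: n => // k _; have [r [sr pr rr]] := hpoly_roots k.
set ps := 0 :: rcons r 1 in rr.
have ups : uniq_roots ps.
  by rewrite uniq_rootsE; apply: (@sorted_uniq _ <%R lt_trans ltxx).
have hE : hpoly k = lead_coef (hpoly k) *: \prod_(z <- ps) ('X - z%:P).
  by apply: all_roots_prod_XsubC => //; rewrite size_hpoly /= size_rcons sr.
have sumE f : sum_des k.+1 f = lead_coef (hpoly k) * bern ps f.
  rewrite -ev_sum_des sum_des_hom {1}hE homZ evZ -ev_prod -hom_prod.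
  by rewrite /= size_rcons sr.
exists ps.
  have : path <=%R 0 (rcons r 1) by apply: sub_path pr => x y /ltW.
  move=> /[dup] /(order_path_min le_trans) p0; rewrite rcons_path => /andP[_ _].
  apply/allP => x; rewrite inE /in01 => /predU1P[->|xr]; first by rewrite lexx ler01.
  rewrite (allP p0)//=; move: xr; rewrite mem_rcons inE => /predU1P[->//|xr].
  have : sorted <=%R (rcons r 1).
    by apply: path_sorted (sub_path _ pr) => ? ? /ltW.
  rewrite sorted_pairwise; last exact: le_trans.
  by rewrite pairwise_rcons => /andP[/allP /(_ _ xr)].
(* The constant function 1 identifies the leading coefficient as the number of permutations. *)
move=> f; rewrite sumE; congr (_ * _).
have := sumE (fun=> 1); rewrite bern_cst mulr1 => <-.
by rewrite /sum_des sumr_const card_Sn.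
Qed.

End RealRooted.

(** * The Eulerian law: moments, Worpitzky's identity, normal approximation *)

Section EulerianExpectation.
Variable R : realType.
Implicit Types (f g : nat -> R) (n m k : nat) (y : R).

Definition eulerE n f : R := sum_des n f / n`!%:R.

Lemma fact_neq0 n : n`!%:R != 0 :> R.
Proof. by rewrite pnatr_eq0 -lt0n fact_gt0. Qed.

Lemma sum_desD n f g : sum_des n (fun d => f d + g d) = sum_des n f + sum_des n g.
Proof. exact: big_split. Qed.

Lemma sum_desZ n (c : R) f : sum_des n (fun d => c * f d) = c * sum_des n f.
Proof. by rewrite /sum_des mulr_sumr. Qed.

Lemma sum_des_cst n (c : R) : sum_des n (fun=> c) = n`!%:R * c.
Proof. by rewrite /sum_des sumr_const card_Sn mulr_natl. Qed.

Lemma eulerED n f g : eulerE n (fun d => f d + g d) = eulerE n f + eulerE n g.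
Proof. by rewrite /eulerE sum_desD mulrDl. Qed.

Lemma eulerEZ n (c : R) f : eulerE n (fun d => c * f d) = c * eulerE n f.
Proof. by rewrite /eulerE sum_desZ mulrA. Qed.

Lemma eulerE_cst n (c : R) : eulerE n (fun=> c) = c.
Proof. by rewrite /eulerE sum_des_cst mulrC mulKf ?fact_neq0. Qed.

Lemma descents_le n (s : 'S_n) : (#|descents s| <= n)%N.
Proof. by rewrite -[n in (_ <= n)%N]card_ord max_card. Qed.

Lemma sum_des_le n f g : (forall d, (0 < d <= n.+1)%N -> f d <= g d) ->
  sum_des n f <= sum_des n g.
Proof. by move=> fg; apply: ler_sum => s _; apply: fg; rewrite /= ltnS descents_le. Qed.

Lemma eulerE_le n f g : (forall d, (0 < d <= n.+1)%N -> f d <= g d) ->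
  eulerE n f <= eulerE n g.
Proof. by move=> fg; rewrite ler_pM2r ?sum_des_le// invr_gt0 ltr0n fact_gt0. Qed.

Lemma eq_eulerE n f g : f =1 g -> eulerE n f = eulerE n g.
Proof. by move=> /funext ->. Qed.

Lemma eulerE_recr n f : eulerE n.+1 f =
  eulerE n (fun d => (d%:R * f d + (n.+1%:R - d%:R) * f d.+1) / n.+1%:R).
Proof.
rewrite /eulerE sum_des_recr factS natrM invfM mulrA; congr (_ / _).
by rewrite /sum_des mulr_suml.
Qed.

Lemma eulerE_le_succ n f g : (forall d, f d <= g d) -> (forall d, f d <= g d.+1) ->
  eulerE n f <= eulerE n.+1 g.
Proof.
move=> fg fg1; rewrite eulerE_recr; apply: eulerE_le => d /andP[d0 dn].
rewrite ler_pdivlMr ?ltr0n//.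
have dn' : 0 <= n.+1%:R - d%:R :> R by rewrite subr_ge0 ler_nat.
have := ler_wpM2l (ler0n R d) (fg d); have := ler_wpM2l dn' (fg1 d); lra.
Qed.

Lemma eulerE_0 f : eulerE 0 f = f 1%N.
Proof. by rewrite /eulerE sum_des0 divr1. Qed.

Lemma eulerE_mean n : (0 < n)%N -> eulerE n (fun d => d%:R) = n.+1%:R / 2.
Proof.
case: n => // n _; elim: n => [|n IH].
  by rewrite eulerE_recr eulerE_0; field.
have n1 : n.+2%:R != 0 :> R by rewrite pnatr_eq0.
rewrite eulerE_recr (@eq_eulerE _ _ (fun d => n.+1%:R / n.+2%:R * d%:R + 1)); last first.
  by move=> d; rewrite -[d.+1%:R]natr1 -[n.+2%:R]natr1 in n1 *; field.
rewrite eulerED eulerEZ eulerE_cst IH.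
by rewrite -[n.+3%:R]natr1 -[n.+2%:R]natr1 in n1 *; field.
Qed.

Lemma eulerE_var n : (1 < n)%N ->
  eulerE n (fun d => (d%:R - n.+1%:R / 2) ^+ 2) = n.+1%:R / 12.
Proof.
(* An affine recurrence for the variance. At [m = 1] its factor [1 - 2 / (m + 1)] vanishes, so the
   closed form holds from [n = 2] on. *)
have step m : (0 < m)%N -> eulerE m.+1 (fun d => (d%:R - m.+2%:R / 2) ^+ 2) =
    (1 - 2 / m.+1%:R) * eulerE m (fun d => (d%:R - m.+1%:R / 2) ^+ 2) + 4^-1.
  move=> m0; have m1 : m.+1%:R != 0 :> R by rewrite pnatr_eq0.
  rewrite eulerE_recr -(eulerE_cst m 4^-1) -eulerEZ -eulerED; apply: eq_eulerE => d.
  by rewrite -[d.+1%:R]natr1 -[m.+2%:R]natr1; field.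
case: n => [|[|n]] // _; elim: n => [|n IH]; rewrite step//.
  by rewrite (_ : 1 - 2 / 2 = 0) ?mul0r; field.
have n1 : n.+3%:R != 0 :> R by rewrite pnatr_eq0.
by rewrite IH -[n.+4%:R]natr1; field.
Qed.

Lemma worpitzky n m : sum_des n (fun d => 'C(m + n - d, n)%:R) = m%:R ^+ n :> R.
Proof.
elim: n => [|n IH]; first by rewrite sum_des0 bin0 expr0.
rewrite sum_des_recr exprS -IH -sum_desZ; apply: eq_bigr => s _.
have := descents_le s; move: #|_| => d dn.
rewrite addnS !subSS.
(* Truncated subtraction: here [d <= n] forces [m = 0], and both sides are 0. *)
have [mnd|dmn] := ltnP (m + n)%N d.+1.
  have m0 : m = 0%N by lia.
  rewrite m0 mul0r (_ : 0 + n - d = 0)%N; last lia.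
  rewrite (_ : 0 + n - d.+1 = 0)%N; last lia.
  by rewrite bin_small// !mulr0 addr0.
have -> : (m + n - d = (m + n - d.+1).+1)%N by lia.
set x := (m + n - d.+1)%N.
apply: (mulfI (_ : n.+1%:R != 0 :> R)); first by rewrite pnatr_eq0.
have h1 : n.+1%:R * 'C(x.+1, n.+1)%:R = x.+1%:R * 'C(x, n)%:R :> R.
  by rewrite -!natrM -mul_bin_diag.
have h2 : n.+1%:R * 'C(x, n.+1)%:R = (x%:R - n%:R) * 'C(x, n)%:R :> R.
  have [xn|nx] := ltnP x n; first by rewrite !bin_small ?mulr0// ltnW.
  by rewrite -natrB// -!natrM mul_bin_left.
rewrite mulrDr mulrCA h1 [X in _ + X]mulrCA h2.
have -> : x%:R = m%:R + n%:R - d.+1%:R :> R by rewrite /x natrB// natrD.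
have -> : x.+1%:R = m%:R + n%:R - d%:R :> R.
  by rewrite -natr1 /x natrB// natrD -natr1; ring.
rewrite -[d.+1%:R]natr1 -[n.+1%:R]natr1; ring.
Qed.

Definition eulerF n y := eulerE n (fun d => (d%:R <= y)%R%:R).

(** The 4 bounds [sqrt 12], from the variance [(n + 1) / 12]; [mills 0 + 3] is the constant of
    [bern_berry_esseen]. *)
Definition be_const : R := 4 * (mills 0 + 3).

Lemma be_const_ge : 12 <= be_const.
Proof. by have := mills_ge0 (0 : R); rewrite /be_const; lra. Qed.

Lemma sqrt12 n : (Num.sqrt (n.+1%:R / 12))^-1 <= 4 / Num.sqrt n.+1%:R :> R.
Proof.
rewrite sqrtrM ?ler0n// invfM mulrC ler_wpM2r ?invr_ge0 ?sqrtr_ge0//.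
rewrite sqrtrV// invrK -[leRHS](@gtr0_norm R)// -sqrtr_sqr ler_wsqrtr//.
by rewrite expr2; lra.
Qed.

Lemma eulerF_berry_esseen n y : (1 < n)%N ->
  `|eulerF n y - Phi ((y - n.+1%:R / 2) / Num.sqrt (n.+1%:R / 12))|
    <= be_const / Num.sqrt n.+1%:R.
Proof.
move=> n1; have n0 := ltnW n1.
have [ps ps01 psE] := sum_des_bern R n0.
have EE f : eulerE n f = bern ps f by rewrite /eulerE psE mulrC mulKf ?fact_neq0.
have mE : bern_mean ps = n.+1%:R / 2.
  apply/eqP; rewrite -(eulerE_mean n0) EE eq_sym -subr_eq0 -(bern_centered ps01).
  by rewrite (bernD ps (fun k => k%:R) (fun=> - bern_mean ps)) bern_cst.
have vE : bern_var ps = n.+1%:R / 12.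
  by rewrite -(bern_second_moment ps01) -(eulerE_var n1) EE mE.
have v0 : 0 < bern_var ps by rewrite vE divr_gt0.
have := bern_berry_esseen y ps01 v0; rewrite /eulerF EE mE vE => /le_trans; apply.
rewrite [be_const]mulrC /be_const -mulrA ler_wpM2l ?sqrt12//.
by have := mills_ge0 (0 : R); lra.
Qed.

Lemma eulerF_ge0 n y : 0 <= eulerF n y.
Proof. by rewrite -(eulerE_cst n 0); apply: eulerE_le => d _; rewrite ler0n. Qed.

Lemma eulerF_le1 n y : eulerF n y <= 1.
Proof.
rewrite -(eulerE_cst n 1); apply: eulerE_le => d _.
by rewrite (_ : 1 = 1%:R)// ler_nat leq_b1.
Qed.

(** Two Berry-Esseen errors, and the increment of [Phi] over one unit divided by the standard
    deviation, which is of the same size. *)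
Definition pmf_const : R := 3 * be_const.

Lemma eulerF_increment n y :
  eulerF n y - eulerF n (y - 1) <= pmf_const / Num.sqrt n.+1%:R.
Proof.
have s0 : 0 < Num.sqrt n.+1%:R :> R by rewrite sqrtr_gt0.
have b12 := be_const_ge.
have [n1|n1] := ltnP 1 n; last first.
  rewrite ler_pdivlMr//; have := eulerF_ge0 n (y - 1); have := eulerF_le1 n y.
  have : Num.sqrt n.+1%:R <= 2 :> R.
    rewrite -[leRHS](@gtr0_norm R)// -sqrtr_sqr ler_wsqrtr// expr2 -natrM ler_nat; lia.
  rewrite /pmf_const; nra.
have := eulerF_berry_esseen y n1; have := eulerF_berry_esseen (y - 1) n1.
set s := Num.sqrt (_ / 12).
have := Phi_lipschitz ((y - n.+1%:R / 2) / s) ((y - 1 - n.+1%:R / 2) / s).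
rewrite -mulrBl [_ - _ - (_ - _)](_ : _ = 1); last by ring.
have sV0 : 0 < s^-1 by rewrite invr_gt0 sqrtr_gt0 divr_gt0.
have := sqrt12 n; rewrite -/s mul1r (gtr0_norm sV0) /pmf_const.
rewrite -[3 * be_const / _]mulrA; have : 4 / Num.sqrt n.+1%:R <= be_const / Num.sqrt n.+1%:R.
  by rewrite ler_pM2r ?invr_gt0//; lra.
rewrite !ler_norml => ? ? /andP[? ?] /andP[? ?] /andP[? ?]; lra.
Qed.

Lemma eulerF_homo n : {homo eulerF n : x y / x <= y}.
Proof.
move=> x y xy; apply: eulerE_le => d _; rewrite ler_nat.
by case: (leP (d%:R : R) x) => // dx; rewrite (le_trans dx xy).
Qed.

End EulerianExpectation.

Local Close Scope classical_set_scope.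

(** * Sequences compatible with the descents of a permutation *)

Section CompatibleSequences.
Variable m : nat.

(* Lexicographic order on pairs (value, position in the word), written additively. *)
Definition lexle (p q : nat * nat) := (p.1 + (q.2 < p.2)%N <= q.1)%N.

Lemma lexle_trans : transitive lexle.
Proof. by move=> [b y] [a x] [c z]; rewrite /lexle /=; lia. Qed.

Lemma card_tuple_cons (T : finType) n (P : pred (seq T)) :
  #|[set t : n.+1.-tuple T | P t]| = (\sum_(b : T) #|[set t : n.-tuple T | P (b :: t)]|)%N.
Proof.
rewrite -sum1_card big_mkcond /=.
under [RHS]eq_bigr => b _ do rewrite -sum1_card big_mkcond.
rewrite pair_bigA /=.
rewrite (reindex (fun u : T * n.-tuple T => [tuple of u.1 :: u.2])) /=.
  by apply: eq_bigr => u _; rewrite !inE.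
exists (fun t : n.+1.-tuple T => (thead t, [tuple of behead t])) => [[b t] _|t _] /=.
  by congr (_, _); apply/val_inj.
by apply/val_inj; rewrite /= {3}(tuple_eta t).
Qed.

Lemma sum_ord_ge a (g : nat -> nat) :
  (\sum_(b < m | (a <= b)%N) g (m - b)%N = \sum_(j < m - a) g j.+1)%N.
Proof.
elim: m a => [|k IH] a; first by rewrite sub0n !big_ord0.
rewrite big_mkcond big_ord_recl /=; under eq_bigr => b _ do rewrite /bump add1n subSS.
case: a => [|a] /=.
  rewrite big_ord_recr /= addnC; congr (_ + _)%N.
  have := IH 0%N; rewrite subn0 big_mkcond /= => <-.
  exact: eq_bigr.
by rewrite add0n subSS -IH [RHS]big_mkcond /=; apply: eq_bigr => b _; rewrite ltnS.
Qed.

Lemma sum_binomial_shift k c J : (c <= k)%N ->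
  (\sum_(j < J) 'C(j + c, k) = 'C(J + c, k.+1))%N.
Proof.
move=> ck; elim: J => [|J IH]; first by rewrite big_ord0 bin_small.
by rewrite big_ord_recr /= IH addSn binS.
Qed.

(** These sequences increase weakly, and strictly at the descents of [x0 :: w]; [(b0, x0)] is the
    pair read before. Summing over the first value is the hockey-stick identity
    [sum_binomial_shift]. *)
Lemma card_compatible_path (b0 x0 : nat) (w : seq nat) :
  #|[set t : (size w).-tuple 'I_m | path lexle (b0, x0) (zip (map val t) w)]| =
  'C(m - b0 + size w - (desw (x0 :: w)).+1, size w).
Proof.
elim: w b0 x0 => [|x w IH] b0 x0.
  rewrite bin0 (eq_card (B := predT)) ?card_tuple ?expn0// => t.
  by rewrite !inE (tuple0 t).
pose P (s : seq 'I_m) := path lexle (b0, x0) (zip (map val s) (x :: w)).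
rewrite -/(size (x :: w)) [size (x :: w)]/= (card_tuple_cons _ P) /P /=.
set e : nat := (x < x0)%N; set d := desw (x :: w).
have dw : (d <= size w)%N by have := desw_le_size (x :: w).
have -> : (\sum_(b : 'I_m) #|[set t : (size w).-tuple 'I_m |
      lexle (b0, x0) (val b, x) && path lexle (val b, x) (zip (map val t) w)]| =
    \sum_(b < m | (b0 + e <= b)%N) 'C(m - b + size w - d.+1, size w))%N.
  rewrite [RHS]big_mkcond; apply: eq_bigr => b _.
  have lexE : lexle (b0, x0) (val b, x) = (b0 + e <= b)%N by [].
  case: ifP => be; last by apply: eq_card0 => t; rewrite !inE lexE be.
  by rewrite -(IH b x); apply: eq_card => t; rewrite !inE lexE be.
rewrite (sum_ord_ge _ (fun j => 'C(j + size w - d.+1, size w))).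
under eq_bigr => j _ do rewrite addSn subSS -addnBA//.
rewrite sum_binomial_shift ?leq_subr//.
rewrite -/(desw (x :: w)) -/d.
(* If a strict step is required and [m - b0 = 0], truncated subtraction makes the two upper indices
   differ, but both binomials vanish. *)
have [h|h] := leqP e (m - b0).
  by congr 'C(_, _); lia.
by rewrite !bin_small//; lia.
Qed.

Lemma card_compatible n (s : 'S_n) :
  #|[set t : n.-tuple 'I_m | sorted lexle (zip (map val t) (word s))]| =
  'C(m + n - #|descents s|.+1, n).
Proof.
have := card_compatible_path 0 0 (word s); rewrite card_descents.
rewrite subn0; have -> : desw (0%N :: word s) = desw (word s).
  by case: (word s).
have pathE (l : seq (nat * nat)) : path lexle (0, 0)%N l = sorted lexle l.
  by case: l => //= p l; rewrite /lexle /= ltn0 leq0n.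
move: (size_word s); set w := word s; move: w => w wn.
case: n / wn {s} => <-; apply: eq_card => t; by rewrite !inE pathE.
Qed.

End CompatibleSequences.

(** * Labelled involutions and symmetric matrices *)

Lemma rearrangement2 a b c d : (a < b)%N -> (d < c)%N -> (a * c + b * d < a * d + b * c)%N.
Proof.
move=> ab dc; rewrite -(subnKC ab) -(subnKC dc).
by move: (b - _)%N (c - _)%N => k l; rewrite !(mulnDl, mulnDr); lia.
Qed.

(** If [r] moved [x], monotonicity on the fibre of [x] would make the iterates of [r] from [x]
    strictly monotone, which is impossible among [n] positions. *)
Lemma fiber_increasing_perm_id (T : eqType) n (L : 'I_n -> T) (r : 'S_n) :
  (forall x, L (r x) = L x) ->
  (forall x y : 'I_n, (x < y)%N -> L x = L y -> (r x < r y)%N) -> r = 1%g.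
Proof.
move=> rL rincr; apply/permP => x; rewrite perm1; apply/val_inj => /=.
have iterL k y : L (iter k r y) = L y by elim: k => //= k IH; rewrite rL IH.
case: (ltngtP (r x) x) => // [rx|xr].
  have step k : (iter k.+1 r x < iter k r x)%N.
    by elim: k => // k IH; apply: rincr => //; rewrite !iterL.
  have bound k : (iter k r x + k <= x)%N.
    by elim: k => [|k IH]; rewrite ?addn0//; have := step k; lia.
  by have := bound n; have := ltn_ord x; lia.
have step k : (iter k r x < iter k.+1 r x)%N.
  by elim: k => // k IH; apply: rincr => //; rewrite !iterL.
have bound k : (k <= iter k r x)%N.
  by elim: k => // k IH; have := step k; lia.
by have := bound n; have := ltn_ord (iter n r x); lia.
Qed.

Section SymmetricMatrices.
Variables n m : nat.
Notation P := ('I_m * 'I_m)%type.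
Implicit Types (p q : P) (u : 'S_n * n.-tuple 'I_m).

Definition swap p : P := (p.2, p.1).

Lemma swapK : involutive swap. Proof. by case. Qed.

Definition code p : nat := (p.1 * m + p.2)%N.

Lemma code_lt p q : (code p < code q)%N = (p.1 < q.1)%N || ((p.1 == q.1) && (p.2 < q.2)%N).
Proof.
rewrite /code -val_eqE /=; have := ltn_ord p.2; have := ltn_ord q.2.
move: (val p.1) (val p.2) (val q.1) (val q.2) => a b c d dm bm.
case: (ltngtP a c) => /= [ac|ca|->]; last by rewrite ltn_add2l.
- have : ((a.+1) * m <= c * m)%N by rewrite leq_mul2r ac orbT.
  by rewrite mulSn; lia.
- have : ((c.+1) * m <= a * m)%N by rewrite leq_mul2r ca orbT.
  by rewrite mulSn; lia.
Qed.

Lemma code_inj : injective code.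
Proof.
move=> [a b] [c d] pq.
have := code_lt (a, b) (c, d); have := code_lt (c, d) (a, b).
rewrite pq ltnn -!val_eqE /= => h1 h2; congr (_, _); apply: val_inj => /=.
  by move: h1 h2; case: (ltngtP a c).
by move: h1 h2; case: (ltngtP a c) => //= _; case: (ltngtP b d).
Qed.

(* Over a fixed involution there are ['C(m + n - d, n)] such words, [d] being the number of descents
   plus one; all together they biject with the symmetric m x m matrices over nat of entry sum n. *)
Definition labelled u :=
  (u.1 \in involutions n) && sorted lexle (zip (map val u.2) (word u.1)).

Lemma labelledP u : reflect
  ((forall x, u.1 (u.1 x) = x) /\ forall x y : 'I_n, (x < y)%N ->
    (tnth u.2 x < tnth u.2 y)%N \/
    tnth u.2 x = tnth u.2 y /\ (u.1 x < u.1 y)%N)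
  (labelled u).
Proof.
case: u => s t; rewrite /labelled /=.
have -> : zip (map val t) (word s) = [seq (val (tnth t x), val (s x)) | x <- enum 'I_n].
  by rewrite -{1}(map_tnth_enum t) -map_comp /word zip_map.
have lexleE (x y : 'I_n) : (x < y)%N ->
    lexle (val (tnth t x), val (s x)) (val (tnth t y), val (s y)) ->
    (tnth t x < tnth t y)%N \/ tnth t x = tnth t y /\ (s x < s y)%N.
  move=> xy; rewrite /lexle /=.
  have sxy : val (s x) != val (s y) by rewrite val_eqE (inj_eq perm_inj) -val_eqE neq_ltn xy.
  case: (ltngtP (tnth t x) (tnth t y)) => [|h|/val_inj ->]; [by left|lia|].
  by move=> h; right; split=> //; move: h sxy; case: ltngtP => //=; rewrite addn1 ltnn.
rewrite sorted_map sorted_pairwise; last by move=> y x z; exact: lexle_trans.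
apply: (iffP andP) => [[+ /pairwiseP H]|[sK H]].
  rewrite inE => /eqP s2; split=> [x|x y xy].
    by rewrite -permM -expg2 s2 perm1.
  apply: lexleE => //; have := H x x y; rewrite !inE size_enum_ord !ltn_ord !nth_ord_enum.
  exact.
split; first by rewrite inE; apply/eqP/permP => x; rewrite expg2 permM sK perm1.
have [n0|n0] := posnP n.
  by rewrite (size0nil (_ : size (enum 'I_n) = 0%N)) // size_enum_ord.
pose x0 := Ordinal n0.
apply/(pairwiseP x0) => i j; rewrite !inE size_enum_ord => ilt jlt ij.
rewrite (nth_ord_enum x0 (Ordinal ilt)) (nth_ord_enum x0 (Ordinal jlt)) /lexle /=.
by case: (H (Ordinal ilt) (Ordinal jlt) ij) => [|[-> /=]]; lia.
Qed.

(** The cells of the matrix, each repeated as often as its entry says. The matrix is symmetric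
    because [u.1] is an involution; the condition on the word makes the list sorted, hence
    determined by the matrix. *)
Definition pairs u : seq P := [seq (tnth u.2 x, tnth u.2 (u.1 x)) | x <- enum 'I_n].

Lemma size_pairs u : size (pairs u) = n.
Proof. by rewrite size_map size_enum_ord. Qed.

Lemma nth_pairs u (x : 'I_n) d :
  nth d (pairs u) x = (tnth u.2 x, tnth u.2 (u.1 x)).
Proof. by rewrite (nth_map x) ?size_enum_ord// nth_ord_enum. Qed.

Lemma pairs_sym u : labelled u -> perm_eq (map swap (pairs u)) (pairs u).
Proof.
move=> /labelledP[sK _].
have -> : map swap (pairs u) =
    [seq (tnth u.2 x, tnth u.2 (u.1 x)) | x <- [seq u.1 x | x <- enum 'I_n]].
  by rewrite -!map_comp; apply: eq_map => x /=; rewrite sK.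
apply: perm_map; apply: uniq_perm; last 1 first.
- move=> x; rewrite mem_enum -[x in LHS]sK.
  by apply/mapP; exists (u.1 x) => //; rewrite mem_enum.
- by rewrite (map_inj_uniq perm_inj) enum_uniq.
- exact: enum_uniq.
Qed.

Lemma pairs_sorted u : labelled u -> sorted leq (map code (pairs u)).
Proof.
move=> /labelledP[sK H]; rewrite -map_comp sorted_map.
apply: (@sub_sorted _ (relpre val ltn)); last first.
  by rewrite -sorted_map val_enum_ord iota_ltn_sorted.
move=> x y /= xy; rewrite leqNgt code_lt /= negb_or -leqNgt -val_eqE negb_and -leqNgt.
case: (H x y xy) => [h|[-> sxy]]; first by rewrite (ltnW h) /= gtn_eqF.
rewrite leqnn eqxx /=; case: (H _ _ sxy) => [/ltnW//|[-> _]//].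
Qed.

(** Equal multisets give equal sorted lists, hence [u.2 = u'.2]. Then [u.1 * u'.1] preserves cells
    and is increasing on equal cells, so it is the identity. *)
Lemma pairs_inj u u' : labelled u -> labelled u' ->
  perm_eq (pairs u) (pairs u') -> u = u'.
Proof.
move=> lu lu' uu'.
have pE : pairs u = pairs u'.
  apply: (inj_map code_inj).
  apply: (sorted_eq leq_trans anti_leq (pairs_sorted lu) (pairs_sorted lu')).
  exact: perm_map.
have LE x : (tnth u.2 x, tnth u.2 (u.1 x)) = (tnth u'.2 x, tnth u'.2 (u'.1 x)).
  by rewrite -(nth_pairs u x (tnth u.2 x, tnth u.2 x)) pE nth_pairs.
have tE : u.2 = u'.2 by apply: eq_from_tnth => x; have [] := LE x.
move: lu lu' => /labelledP[sK H] /labelledP[sK' H'].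
have r1 : (u.1 * u'.1)%g = 1%g.
  apply: (@fiber_increasing_perm_id _ _ (fun x => (tnth u.2 x, tnth u.2 (u.1 x)))) => [x|x y xy].
    have tsE z : tnth u.2 (u.1 z) = tnth u.2 (u'.1 z).
      by have [_ ->] := LE z; rewrite tE.
    by rewrite permM; congr (_, _); rewrite -?tsE ?sK// tsE sK'.
  case=> t1 t2; rewrite !permM.
  have sxy : (u.1 x < u.1 y)%N by case: (H x y xy) => [|[]//]; rewrite t1 ltnn.
  by case: (H' _ _ sxy) => [|[]//]; rewrite -tE t2 ltnn.
case: u u' tE r1 {LE uu' pE H H'} sK sK' => [s t] [s' t'] /= -> r1 sK sK'; congr (_, _).
apply/permP => x; have := congr1 (fun r : 'S_n => r (s x)) r1.
by rewrite permM perm1 sK.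
Qed.

Lemma ex_labelled (l : seq P) : size l = n -> perm_eq (map swap l) l ->
  exists2 u, labelled u & perm_eq (pairs u) l.
Proof.
move=> sl lsym; pose le p q := (code p <= code q)%N.
have le_total : total le by move=> p q; exact: leq_total.
have le_tr : transitive le by move=> p q r; exact: leq_trans.
have szL : size (sort le l) == n by rewrite size_sort sl.
pose L := Tuple szL.
have Lsorted (x y : 'I_n) : (x <= y)%N -> le (tnth L x) (tnth L y).
  move=> xy; have := tnth L x => p0; rewrite !(tnth_nth p0).
  apply: (sorted_leq_nth le_tr _ _ (sort_sorted le_total l)) => //.
  - by move=> p; exact: leqnn.
  - by rewrite inE size_sort sl.
  - by rewrite inE size_sort sl.
have Lperm : perm_eq [tuple of map swap L] L.
  rewrite /= perm_sym perm_sort; apply: perm_trans (_ : perm_eq _ (map swap l)) _.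
    by rewrite perm_sym.
  by apply: perm_map; rewrite perm_sym perm_sort.
have /tuple_permP[s0 /= s0E] := Lperm.
pose good (s : 'S_n) := [forall x, tnth L (s x) == swap (tnth L x)].
have good0 : good s0.
  apply/forallP => x; have /(congr1 (fun s => nth (tnth L x) s x)) := s0E.
  rewrite (nth_map (tnth L x)) ?size_sort ?sl// (nth_map x) ?size_enum_ord//.
  by rewrite nth_ord_enum -(tnth_nth _ L) => ->.
(* Among the permutations realising the transposition of cells, a maximiser of [x * s x] summed over
   [x] is increasing on equal cells: composing with [tperm x y] would undo an inversion there
   without leaving [good]. Then [s * s] preserves cells and increases on equal ones, so it is the
   identity. *)
case: (arg_maxnP (fun s : 'S_n => \sum_(x < n) x * s x)%N good0) => s /forallP sP smax.
have {}sP x : tnth L (s x) = swap (tnth L x) by apply/eqP.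
have sincr (x y : 'I_n) : (x < y)%N -> tnth L x = tnth L y -> (s x < s y)%N.
  move=> xy Lxy; rewrite ltnNge leq_eqVlt; apply/negP => /orP[|syx].
    by rewrite val_eqE (inj_eq perm_inj) -val_eqE gtn_eqF.
  have gtp : good (tperm x y * s)%g.
    by apply/forallP => z; rewrite permM sP; case: tpermP => [->|->|_ _]; rewrite ?Lxy.
  have yx : y != x by rewrite -val_eqE gtn_eqF.
  suff : (\sum_(x < n) x * s x < \sum_(z < n) z * (tperm x y * s)%g z)%N.
    by rewrite ltnNge => /negP; apply; exact: smax gtp.
  rewrite (bigD1 x)//= (bigD1 y)//= [X in (_ < X)%N](bigD1 x)//= [X in (_ < _ + X)%N](bigD1 y)//=.
  rewrite !permM tpermL tpermR !addnA.
  rewrite (eq_bigr (fun z : 'I_n => z * (tperm x y * s)%g z)%N); last first.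
    by move=> z /andP[zx zy]; rewrite permM tpermD// eq_sym.
  by rewrite ltn_add2r rearrangement2.
have s2 : (s * s)%g = 1%g.
  apply: (@fiber_increasing_perm_id _ _ (tnth L)) => [x|x y xy Lxy].
    by rewrite permM !sP swapK.
  by rewrite !permM; apply: (sincr); rewrite ?sP ?Lxy//; exact: sincr.
pose u : 'S_n * n.-tuple 'I_m := (s, [tuple of map fst L]).
have uE x : (tnth u.2 x, tnth u.2 (u.1 x)) = tnth L x.
  by rewrite !tnth_map /= sP; case: (tnth L x).
exists u.
  apply/labelledP; split => [x|x y xy].
    by rewrite /= -permM s2 perm1.
  have := Lsorted _ _ (ltnW xy); rewrite /le leq_eqVlt code_lt (inj_eq code_inj) !tnth_map /=.
  case/orP => [/eqP Lxy|/orP[h|/andP[/eqP h1 h2]]]; [|by left|].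
    by right; rewrite Lxy; split => //; exact: sincr.
  right; split => //; rewrite ltnNge; apply/negP => /Lsorted.
  by rewrite /le !sP leqNgt code_lt /= h2.
have -> : pairs u = sort le l.
  by rewrite /pairs (eq_map uE) map_tnth_enum.
by rewrite perm_sort.
Qed.

End SymmetricMatrices.

(** * The generating function of symmetric matrices by entry sum *)

Section CountSymmetric.
Variables (K m : nat).
Notation P := ('I_m * 'I_m)%type.
Implicit Types (p q : P) (M : {ffun P -> 'I_K.+1}).

Definition mult p : nat := if p.1 == p.2 then 1 else 2.
Definition upper_supported M := [forall p : P, (p.1 <= p.2)%N || (M p == 0%N :> nat)].
Definition total M : nat := (\sum_(p : P) mult p * M p)%N.

(* A symmetric matrix is recorded by its upper triangle, off-diagonal entries counting twice. *)
Definition fullmx M p : nat := if (p.1 <= p.2)%N then M p else M (swap p).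

Lemma fullmx_swap M p : fullmx M (swap p) = fullmx M p.
Proof.
case: p => a b; rewrite /fullmx /swap /=; case: ltngtP => // ab.
by rewrite (val_inj ab).
Qed.

Lemma sum_fullmx M : upper_supported M -> (\sum_(p : P) fullmx M p = total M)%N.
Proof.
move=> /forallP Msupp; rewrite /total.
have -> : (\sum_(p : P) fullmx M p = \sum_(p : P) (if (p.1 <= p.2)%N then val (M p) else 0)
   + \sum_(p : P) (if (p.1 <= p.2)%N then 0 else val (M (swap p))))%N.
  rewrite -big_split; apply: eq_bigr => p _; rewrite /fullmx /=.
  by case: (p.1 <= p.2)%N; rewrite ?addn0 ?add0n.
rewrite [X in (_ + X)%N](reindex_inj (can_inj (@swapK m))) -big_split /=.
apply: eq_bigr => p _; have := Msupp p; case: p => a b; rewrite /mult /swap /= -val_eqE /=.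
by case: ltngtP => /= _ ; rewrite ?addn0 ?mul1n ?mul2n ?addnn// => /eqP ->.
Qed.

Lemma sum_count_mem (T : finType) (s : seq T) : (\sum_(x : T) count_mem x s = size s)%N.
Proof.
elim: s => [|y s IH] /=; first by rewrite big1.
rewrite big_split /= IH (bigD1 y)//= eqxx big1 ?addn0 ?add1n// => x xy.
by rewrite eq_sym (negbTE xy).
Qed.

Lemma count_swap p (l : seq P) : count_mem p (map (@swap m) l) = count_mem (swap p) l.
Proof.
by rewrite count_map; apply: eq_count => q /=; rewrite -(inj_eq (can_inj (@swapK m))) swapK.
Qed.

Section FixedSize.
Variable n : nat.
Hypothesis nK : (n <= K)%N.

Definition upper_of (u : 'S_n * n.-tuple 'I_m) : {ffun P -> 'I_K.+1} :=
  [ffun p : P => if (p.1 <= p.2)%N then inord (count_mem p (pairs u)) else ord0].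

Lemma upper_ofE (u : 'S_n * n.-tuple 'I_m) p : labelled u ->
  fullmx (upper_of u) p = count_mem p (pairs u).
Proof.
move=> lu; have cE q : nat_of_ord (@inord K (count_mem q (pairs u))) = count_mem q (pairs u).
  by rewrite inordK// ltnS (leq_trans (count_size _ _))// size_pairs.
rewrite /fullmx !ffunE; case: p => a b /=; case: ltngtP => //= _; rewrite cE//.
by rewrite -count_swap; apply/seq.permP; exact: pairs_sym.
Qed.

(** [K] bounds the entries so that matrices form a finite type; an entry sum [n <= K] makes the
    bound harmless. *)
Lemma card_labelled_upper :
  #|[set u : 'S_n * n.-tuple 'I_m | labelled u]| =
  #|[set M | upper_supported M & total M == n]|.
Proof.
have supp u : upper_supported (upper_of u).
  by apply/forallP => p; rewrite ffunE; case: leqP.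
rewrite -(@card_in_imset _ _ upper_of); last first.
  move=> u v; rewrite !inE => lu lv uv; apply: pairs_inj => //.
  by apply/allP => p _; rewrite /= -!upper_ofE// uv.
congr #|pred_of_set _|; apply/setP => M; rewrite inE; apply/imsetP/andP.
  case=> u; rewrite inE => lu ->; split=> //.
  rewrite -sum_fullmx//; under eq_bigr => p _ do rewrite upper_ofE//.
  by rewrite sum_count_mem size_pairs.
move=> [Ms /eqP Mn]; pose l := flatten [seq nseq (fullmx M p) p | p <- enum [set: P]].
have cl p : count_mem p l = fullmx M p.
  rewrite /l count_flatten -map_comp sumnE big_map big_enum /= (bigD1 p) ?inE//=.
  rewrite count_nseq /= eqxx mul1n big1 ?addn0// => q /andP[_ qp].
  by rewrite count_nseq /= (negbTE qp).
have sl : size l = n.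
  by rewrite -sum_count_mem -Mn -sum_fullmx//; apply: eq_bigr.
have lsym : perm_eq (map (@swap m) l) l.
  by apply/allP => p _; rewrite /= count_swap !cl fullmx_swap.
have [u lu ul] := ex_labelled sl lsym; exists u; first by rewrite inE.
apply/ffunP => p; apply/val_inj => /=.
have := upper_ofE p lu; rewrite (seq.permP ul) cl /fullmx.
have := forallP Ms p; have := forallP (supp u) p.
by case: leqP => //= _ /eqP -> /eqP ->.
Qed.

End FixedSize.

(** [1 / (1 - X)], and [1 / (1 - X^2)] for [geomB], truncated but exact up to index [K]: the choices
    for a diagonal entry and for a pair of equal off-diagonal entries. *)
Definition geomA : {poly int} := \sum_(j < K.+1) 'X^j.
Definition geomB : {poly int} := \sum_(j < K.+1) 'X^(2 * j).
Definition npairs : nat := #|[set p : P | (p.1 < p.2)%N]|.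

Lemma card_diag : #|[set p : P | p.1 == p.2]| = m.
Proof.
rewrite -[RHS](card_ord m) -(card_imset predT (_ : injective (fun a : 'I_m => (a, a)))).
  congr #|pred_of_set _|; apply/setP => -[a b]; rewrite inE /=.
  apply/eqP/imsetP => [->|[c _ [-> ->]]//]; by exists b.
by move=> a b [].
Qed.

Lemma npairsE : (m + 2 * npairs = m * m)%N.
Proof.
rewrite -[RHS]/(m * m)%N -{2 3}(card_ord m) -card_prod -(cardsC [set p : P | p.1 == p.2]).
rewrite card_diag; congr (_ + _)%N; rewrite mul2n -addnn.
have -> : ~: [set p : P | p.1 == p.2] =
    [set p : P | (p.1 < p.2)%N] :|: @swap m @: [set p : P | (p.1 < p.2)%N].
  apply/setP => -[a b]; rewrite !inE /= -val_eqE.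
  have -> : ((a, b) \in @swap m @: [set p : P | (p.1 < p.2)%N]) = (b < a)%N.
    apply/imsetP/idP => [[[c d]]|ba]; first by rewrite inE /= => cd [-> ->].
    by exists (b, a); rewrite ?inE.
  by case: ltngtP.
rewrite cardsU card_imset; last exact: can_inj (@swapK m).
rewrite [X in (_ - X)%N](_ : _ = 0%N) ?subn0//; apply: eq_card0 => -[a b].
rewrite !inE /=; apply/andP => -[ab /imsetP[[c d]]]; rewrite inE /= => cd [ac bd].
by move: ab; rewrite ac bd; lia.
Qed.

Lemma coef_genfun n : (n <= K)%N ->
  (geomA ^+ m * geomB ^+ npairs)`_n = #|[set u : 'S_n * n.-tuple 'I_m | labelled u]|%:R.
Proof.
move=> nK; rewrite card_labelled_upper//.
(* Cells below the diagonal contribute the factor 1, so the product runs over all cells and expands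
   over all of [{ffun P -> 'I_K.+1}]. *)
pose F p (j : 'I_K.+1) : {poly int} :=
  if (p.1 <= p.2)%N || (j == 0%N :> nat) then 'X^(mult p * j) else 0.
have -> : geomA ^+ m * geomB ^+ npairs = \prod_(p : P) \sum_j F p j.
  rewrite (bigID (fun p : P => p.1 == p.2)) /=; congr (_ * _).
    rewrite -[in LHS]card_diag -prodr_const; apply: eq_big => p; first by rewrite inE.
    rewrite inE => pp; apply: eq_bigr => j _.
    by rewrite /F /mult pp mul1n; move: pp; case: p => a b /= /eqP ->; rewrite leqnn.
  rewrite /npairs -prodr_const [LHS]big_mkcond [RHS]big_mkcond /=; apply: eq_bigr => -[a b] _.
  rewrite inE /= -val_eqE /=; case: ltngtP => //= ab.
    have ab' : (a == b) = false by rewrite -val_eqE ltn_eqF.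
    by apply: eq_bigr => j _; rewrite /F /mult /= ab' (ltnW ab).
  rewrite big_ord_recl big1 ?addr0 => [|j _].
    by rewrite /F /= orbT muln0.
  by rewrite /F /= leqNgt ab.
rewrite bigA_distr_bigA coef_sum -sum1_card natr_sum [RHS]big_mkcond.
apply: eq_bigr => M _; rewrite inE.
have [Ms|/forallPn[p Mp]] := boolP (upper_supported M); last first.
  by rewrite (bigD1 p)//= /F (negbTE Mp) mul0r coef0.
have -> : \prod_(p : P) F p (M p) = 'X^(total M).
  rewrite /total (big_morph (fun k => 'X^k : {poly int}) (fun k l => exprD _ k l) (expr0 _)).
  by apply: eq_bigr => p _; rewrite /F (forallP Ms p).
by rewrite coefXn eq_sym; case: eqP.
Qed.

Lemma geomA_deriv : (1 - 'X) * geomA^`() = geomA - K.+1%:R * 'X^K.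
Proof.
have AE : (1 - 'X) * geomA = 1 - 'X^(K.+1).
  by rewrite -opprB mulNr -(subrX1 'X) opprB.
have := congr1 (@deriv _) AE.
rewrite derivM !derivB derivX derivXn -polyC1 derivC polyC1 sub0r mulN1r sub0r => AE'.
by rewrite mulr_natl -AE'; ring.
Qed.

Lemma geomB_deriv :
  (1 - 'X^2) * geomB^`() = 2%:R * 'X * geomB - (2 * K.+1)%:R * 'X^((2 * K).+1).
Proof.
have BE : (1 - 'X^2) * geomB = 1 - 'X^((2 * K).+2).
  rewrite -opprB mulNr /geomB; under eq_bigr do rewrite exprM.
  by rewrite -(subrX1 'X^2) opprB -exprM mulnS.
have := congr1 (@deriv _) BE.
rewrite derivM !derivB !derivXn -polyC1 derivC polyC1 !sub0r /= expr1 => BE'.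
have -> : (2 * K.+1)%:R * 'X^((2 * K).+1) = 'X^((2 * K).+1) *+ (2 * K).+2 :> {poly int}.
  by rewrite mulnS mulr_natl.
by rewrite -BE' -mulr_natl; ring.
Qed.

(** For the full series, [1 - X^2] times the logarithmic derivative is [m (1 + X) + 2 npairs X],
    which is [m + m^2 X] by [npairsE]. All truncation errors are divisible by [X^K]. *)
Lemma genfun_deriv : let G := geomA ^+ m * geomB ^+ npairs in
  exists J, (1 - 'X^2) * G^`() = (m%:R + (m * m)%:R * 'X) * G + ('X^K : {poly int}) * J.
Proof.
move=> G.
pose DA := (geomA ^+ m)^`(); pose DB := (geomB ^+ npairs)^`().
have DAE : (1 - 'X) * DA = m%:R * (geomA ^+ m - K.+1%:R * 'X^K * geomA ^+ m.-1).
  rewrite /DA deriv_exp -mulr_natl; case: (m) => [|k]; first by rewrite !mul0r mulr0.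
  rewrite /= (_ : _ * _ = k.+1%:R * (((1 - 'X) * geomA^`()) * geomA ^+ k)); last by ring.
  by rewrite geomA_deriv exprS; ring.
pose c : {poly int} := (2 * K.+1)%:R * 'X^(K.+1).
have BE : (1 - 'X^2) * geomB^`() = 2%:R * 'X * geomB - 'X^K * c.
  by rewrite geomB_deriv mulrCA -exprD addnS addnn -mul2n.
move: (c) BE => {}c BE.
have DBE : (1 - 'X^2) * DB =
    npairs%:R * (2%:R * 'X * geomB ^+ npairs - 'X^K * c * geomB ^+ npairs.-1).
  rewrite /DB deriv_exp -mulr_natl; case: npairs => [|k]; first by rewrite !mul0r mulr0.
  rewrite /= (_ : _ * _ = k.+1%:R * (((1 - 'X^2) * geomB^`()) * geomB ^+ k)); last by ring.
  by rewrite BE exprS; ring.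
exists (- (m%:R * (1 + 'X) * K.+1%:R * geomA ^+ m.-1 * geomB ^+ npairs)
  - npairs%:R * c * geomA ^+ m * geomB ^+ npairs.-1).
have -> : (1 - 'X^2) * G^`() = (1 + 'X) * ((1 - 'X) * DA) * geomB ^+ npairs
    + geomA ^+ m * ((1 - 'X^2) * DB).
  by rewrite /G derivM /DA /DB; ring.
by rewrite DAE DBE /G -npairsE natrD natrM; ring.
Qed.

Lemma genfun_recr n : (n.+2 <= K)%N -> let G := geomA ^+ m * geomB ^+ npairs in
  G`_n.+2 *+ n.+2 = G`_n.+1 *+ m + G`_n *+ (m * m + n).
Proof.
move=> nK G; have [J /(congr1 (fun Q : {poly int} => Q`_n.+1))] := genfun_deriv.
rewrite -/G mulrBl mul1r mulrDl !coefD coefN -mulrA !mulr_natl !coefMn !coefXnM coefXM /=.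
rewrite nK addr0 !coef_deriv subSS => /eqP; rewrite subr_eq => /eqP ->.
rewrite mulrnDr addrA; congr (_ + _).
by case: n nK => [|n] _ /=; rewrite ?mulr0n ?subn1.
Qed.

End CountSymmetric.

Definition labelled_count n m := \sum_(s in involutions n) 'C(m + n - #|descents s|.+1, n).

Lemma labelled_countE n m :
  labelled_count n m = #|[set u : 'S_n * n.-tuple 'I_m | labelled u]|.
Proof.
rewrite -[RHS]sum1_card (eq_bigl (fun u : 'S_n * n.-tuple 'I_m => (u.1 \in involutions n) &&
   (u.2 \in [set t : n.-tuple 'I_m | sorted lexle (zip (map val t) (word u.1))]))).
  rewrite -(pair_big_dep _ (fun s t => t \in [set t : n.-tuple 'I_m |
     sorted lexle (zip (map val t) (word s))]) (fun _ _ => 1%N)) /=.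
  by apply: eq_bigr => s _; rewrite sum1_card card_compatible.
by move=> u; rewrite inE [u.2 \in _]inE.
Qed.

Lemma labelled_count_recr n m :
  (n.+2 * labelled_count n.+2 m =
     m * labelled_count n.+1 m + (m * m + n) * labelled_count n m)%N.
Proof.
have := @genfun_recr n.+2 m n (leqnn _).
cbv zeta; rewrite !coef_genfun //; last by rewrite ltnW.
rewrite !labelled_countE -!mulrnA -!natrD => /eqP.
by rewrite eqr_nat => /eqP; rewrite mulnC [(_ * m)%N]mulnC [X in (_ + X)%N]mulnC.
Qed.

Lemma labelled_count0 m : labelled_count 0 m = 1%N.
Proof.
rewrite /labelled_count (eq_bigr (fun=> 1%N)) => [|s _]; last by rewrite bin0.
rewrite sum1_card; have -> : involutions 0 = [set: 'S_0].
  by apply/setP => s; rewrite !inE; apply/eqP/permP => -[].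
by rewrite cardsT card_Sn.
Qed.

Lemma labelled_count1 m : labelled_count 1 m = m.
Proof.
have S1 (s : 'S_1) : s = 1%g by apply/permP => x; rewrite !ord1.
rewrite /labelled_count (eq_bigr (fun=> m)) => [|s _].
  rewrite sum_nat_const; have -> : involutions 1 = [set: 'S_1].
    by apply/setP => s; rewrite !inE; apply/eqP; rewrite [s]S1 expg1n.
  by rewrite cardsT card_Sn mul1n.
rewrite card_descents (_ : desw _ = 0%N) ?addnK ?subn1 ?addn1 ?bin1//.
by have := size_word s; case: (word s) => [|x [|]].
Qed.

(** * Sums over involutions in terms of Eulerian expectations *)

Section Involutions.
Variable R : realType.
Implicit Types (f g : nat -> R) (n m l k : nat) (y : R).

(* [labelled_count n m = sum_l invg n l * m ^ (n - 2 l) / (n - 2 l)!] *)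
Fixpoint invg n : nat -> R :=
  match n with
  | 0 | 1 => fun l => (l == 0)%N%:R
  | (k.+1 as n').+1 => fun l =>
      ((k.+2 - 2 * l)%:R * invg n' l
       + ((k.+2 - 2 * l) * (k.+2 - 2 * l).-1)%:R * invg k l
       + (if l is l'.+1 then k%:R * invg k l' else 0)) / k.+2%:R
  end.

Lemma nat_ind2 (Q : nat -> Prop) : Q 0%N -> Q 1%N ->
  (forall n, Q n -> Q n.+1 -> Q n.+2) -> forall n, Q n.
Proof.
move=> Q0 Q1 QS n; suff [] : Q n /\ Q n.+1 by [].
by elim: n => // n [Qn Qn1]; split=> //; exact: QS.
Qed.

Lemma invgSS k l : k.+2%:R * invg k.+2 l =
  (k.+2 - 2 * l)%:R * invg k.+1 l
  + ((k.+2 - 2 * l) * (k.+2 - 2 * l).-1)%:R * invg k l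
  + (if l is l'.+1 then k%:R * invg k l' else 0).
Proof. by rewrite mulrC divfK ?pnatr_eq0. Qed.

Lemma invg_ge0 n l : 0 <= invg n l.
Proof.
elim/nat_ind2: n l => [l|l|n IH IH1 l]; rewrite ?ler0n//.
rewrite -(pmulr_rge0 _ (ltr0Sn R n.+1)) invgSS.
by rewrite !addr_ge0 ?mulr_ge0 ?ler0n//; case: l => // l; rewrite mulr_ge0 ?ler0n.
Qed.

Lemma invg_vanish n l : (0 < n <= 2 * l)%N || (n < 2 * l)%N -> invg n l = 0.
Proof.
elim/nat_ind2: n l => [[|l]|[|l]|n IH IH1 l]//= nl.
apply: (mulfI (_ : n.+2%:R != 0 :> R)); first by rewrite pnatr_eq0.
rewrite invgSS mulr0 (_ : n.+2 - 2 * l = 0)%N; last lia.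
rewrite !mul0r !add0r; case: l nl => // l nl.
case: n IH {IH1} nl => [|n] IH nl; first by rewrite mul0r.
by rewrite IH ?mulr0//; lia.
Qed.

Lemma invg0 n : n.+2%:R * invg n.+2 0 =
  n.+2%:R * invg n.+1 0 + (n.+2%:R * n.+1%:R) * invg n 0.
Proof. by rewrite invgSS muln0 subn0 addr0 natrM. Qed.

(** [invg n 0] is the number of involutions for positive [n], so this bounds relative weights. In
    the recursion the weight of index [l] is [2 l] times that of [l - 1], and
    [(n + 2)(n + 1) - a (a - 1) - 2 l n >= 0] for [a = n + 2 - 2 l] closes the induction. *)
Lemma invg_bound n l : (2 ^ l * l`!)%:R * invg n l <= invg n 0.
Proof.
elim/nat_ind2: n l => [[|l]|[|l]|n IH IH1 l]; rewrite ?mulr1 ?mulr0 ?ler01 ?lexx//.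
have [nl|ln] := leqP n.+2 (2 * l).
  by rewrite invg_vanish ?mulr0 ?invg_ge0//; lia.
rewrite -(ler_pM2l (ltr0Sn R n.+1)) mulrCA invgSS invg0.
have aE : (n.+2 - 2 * l)%:R = n.+2%:R - 2 * l%:R :> R by rewrite natrB ?natrM// ltnW.
have bE : (n.+2 - 2 * l).-1%:R = n.+2%:R - 2 * l%:R - 1 :> R.
  by rewrite -subn1 natrB ?subn_gt0// aE.
rewrite [((n.+2 - 2 * l) * _)%:R]natrM aE bE.
case: l => [|l] in ln aE bE *.
  rewrite expn0 fact0 mul1r !mulr0 !subr0 addr0 -[n.+2%:R]natr1; lra.
set c : R := (2 ^ l.+1 * l.+1`!)%:R; set g1 := invg n.+1; set g := invg n.
have cE : c = 2 * l.+1%:R * (2 ^ l * l`!)%:R.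
  by rewrite /c expnS factS -!natrM; congr (_%:R); lia.
have h1 := IH1 l.+1; have h0 := IH l.+1; have h2 := IH l; rewrite -/c in h1 h0.
have l0 : 0 <= l.+1%:R :> R by [].
have a0 : 0 <= n.+2%:R - 2 * l.+1%:R - 1 :> R by rewrite -bE.
have g00 := invg_ge0 n 0; have g10 := invg_ge0 n.+1 0.
have p2 : (n.+2%:R - 2 * l.+1%:R) * (c * g1 l.+1) <= (n.+2%:R - 2 * l.+1%:R) * g1 0%N.
  by rewrite ler_wpM2l//; lra.
have p3 : (n.+2%:R - 2 * l.+1%:R) * (n.+2%:R - 2 * l.+1%:R - 1) * (c * g l.+1)
    <= (n.+2%:R - 2 * l.+1%:R) * (n.+2%:R - 2 * l.+1%:R - 1) * g 0%N.
  by rewrite ler_wpM2l// mulr_ge0//; lra.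
have p4 : n%:R * (2 * l.+1%:R) * ((2 ^ l * l`!)%:R * g l) <= n%:R * (2 * l.+1%:R) * g 0%N.
  by rewrite ler_wpM2l// !mulr_ge0.
have p5 : 0 <= 2 * l.+1%:R * g1 0%N by rewrite !mulr_ge0.
have p6 : 0 <= (2 * l.+1%:R) * (n.+2%:R - 2 * l.+1%:R - 1) * g 0%N by rewrite !mulr_ge0.
have p7 : 0 <= (2 * l.+1%:R) * g 0%N by rewrite !mulr_ge0.
have cg : c * (n%:R * g l) = n%:R * (2 * l.+1%:R) * ((2 ^ l * l`!)%:R * g l).
  by rewrite cE; ring.
rewrite 2!mulrDr cg -[n.+1%:R]natr1.
have nn : n.+2%:R = n%:R + 2 :> R by rewrite -!natr1; ring.
rewrite nn in p2 p3 p6 *.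
move: p2 p3 p4 p5 p6 p7; rewrite !mulrA; lra.
Qed.

Lemma invg_0E l : invg 0 l = (l == 0)%N%:R. Proof. by []. Qed.

Lemma invg_1E l : invg 1 l = (l == 0)%N%:R. Proof. by []. Qed.

Arguments invg : simpl never.

(** For [a = n + 2 - 2 l], the factors [m] and [m^2] of the recurrence turn [m^(a-1) / (a-1)!] and
    [m^(a-2) / (a-2)!] into [a] and [a (a - 1)] times [m^a / a!]: this is the origin of the
    coefficients of [invg]. *)
Lemma labelled_count_invg n m :
  (labelled_count n m)%:R =
    \sum_(l < n.+1) invg n l * (m%:R ^+ (n - 2 * l) / (n - 2 * l)`!%:R).
Proof.
pose T n l : R := m%:R ^+ (n - 2 * l) / (n - 2 * l)`!%:R.
elim/nat_ind2: n => [||n IH IH1].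
- by rewrite labelled_count0 big_ord1 invg_0E /= expr0 divr1 mulr1.
- rewrite labelled_count1 !big_ord_recr big_ord0 !invg_1E /= muln0 subn0 fact0.
  by rewrite mul0r addr0 add0r divr1 mul1r.
apply: (mulfI (_ : n.+2%:R != 0 :> R)); first by rewrite pnatr_eq0.
rewrite -natrM labelled_count_recr natrD !natrM natrD natrM IH IH1.
rewrite [RHS]mulr_sumr [RHS](eq_bigr (fun l : 'I_n.+3 =>
    (n.+2 - 2 * l)%:R * invg n.+1 l * T n.+2 l
  + ((n.+2 - 2 * l) * (n.+2 - 2 * l).-1)%:R * invg n l * T n.+2 l
  + (if val l is l'.+1 then n%:R * invg n l' else 0) * T n.+2 l)); last first.
  by move=> l _; rewrite mulrA invgSS !mulrDl.
rewrite !big_split /= [X in _ = _ + X]big_ord_recl /= mul0r add0r.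
rewrite mulrDl addrA; congr (_ + _ + _).
- rewrite [RHS]big_ord_recr /= invg_vanish ?mulr0 ?mul0r ?addr0; last lia.
  rewrite mulr_sumr; apply: eq_bigr => l _.
  have [ln|nl] := leqP n.+2 (2 * l).
    by rewrite invg_vanish ?mul0r ?mulr0 ?mul0r//; lia.
  rewrite /T; have -> : (n.+2 - 2 * l = (n.+1 - 2 * l).+1)%N by lia.
  rewrite exprS factS natrM; field.
  by rewrite fact_neq0 nat1r pnatr_eq0.
- rewrite [RHS]big_ord_recr [X in _ = X + _]big_ord_recr /= !invg_vanish ?mulr0 ?mul0r ?addr0; [|lia..].
  rewrite mulr_sumr; apply: eq_bigr => l _.
  have [ln|nl] := ltnP n (2 * l).
    by rewrite invg_vanish ?mul0r ?mulr0 ?mul0r//; lia.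
  rewrite /T; have -> : (n.+2 - 2 * l = (n - 2 * l).+2)%N by lia.
  rewrite !exprS !factS !natrM /=; field.
  by rewrite fact_neq0 -!natrD !nat1r !pnatr_eq0.
- rewrite [RHS]big_ord_recr /= invg_vanish ?mulr0 ?mul0r ?addr0; last lia.
  rewrite mulr_sumr; apply: eq_bigr => l _.
  by rewrite /T /bump /= add1n mulnS subnDA subSS subSS subn0 mulrA.
Qed.

Definition dif f k := f k - f k.+1.

Lemma iter_dif_comb j (c d : R) f g k :
  iter j dif (fun k => c * f k + d * g k) k = c * iter j dif f k + d * iter j dif g k.
Proof. by elim: j k => //= j IH k; rewrite /dif !IH; ring. Qed.

Lemma iter_dif_local N j f g : (forall k, (k <= N + j)%N -> f k = g k) ->
  forall k, (k <= N)%N -> iter j dif f k = iter j dif g k.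
Proof.
elim: j N => [|j IH] N fg k kN; first by apply: fg; rewrite addn0.
by rewrite /= /dif !(IH N.+1)// ?ltnS// 1?leqW// => i iN; apply: fg; rewrite addnS -addSn.
Qed.

Lemma iter_dif_0 j f : (forall k, f k = 0) -> iter j dif f =1 fun=> 0.
Proof. by move=> f0; elim: j => [|j IH] k //=; rewrite /dif !IH subrr. Qed.

Definition psi n m k : R := 'C(m + n - k, n)%:R.

(** By Pascal's rule one difference in [k] lowers [n] by one and keeps [m]. So the function summed
    by Worpitzky's identity over [S_(n - 2 l)] is a [2 l]-fold difference of [psi n m]. *)
Lemma iter_dif_psi n m j : (j < n)%N -> iter j dif (psi n m) =1 psi (n - j) m.
Proof.
elim: j => [|j IH] jn k; first by rewrite subn0.
rewrite /= /dif !IH ?(ltnW jn)//.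
have -> : (n - j = (n - j.+1).+1)%N by lia.
have : (0 < n - j.+1)%N by lia.
rewrite /psi; case: (n - j.+1)%N => // i _.
rewrite !addnS subSS; case E : ((m + i).+2 - k)%N => [|x].
  have -> : ((m + i).+1 - k = 0)%N by lia.
  by rewrite !bin_small// subrr.
have -> : ((m + i).+1 - k = x)%N by lia.
by rewrite binS natrD addrC addKr.
Qed.

Definition sum_inv n f : R := \sum_(s in involutions n) f #|descents s|.+1.

(** For [psi n m] this is Worpitzky's identity applied to each power of [m]. Both sides are linear
    in [f] and depend only on its values up to [n + 1], where the functions [psi n m] span
    everything. *)
Lemma sum_inv_expand n f : (0 < n)%N ->
  sum_inv n f = \sum_(l < n.+1) invg n l * eulerE (n - 2 * l) (iter (2 * l) dif f).
Proof.
move=> n0; pose rhs f := \sum_(l < n.+1) invg n l * eulerE (n - 2 * l) (iter (2 * l) dif f).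
rewrite -/(rhs f).
have local h h' : (forall k, (k <= n.+1)%N -> h k = h' k) ->
    sum_inv n h = sum_inv n h' /\ rhs h = rhs h'.
  move=> hh; split; first by apply: eq_bigr => s _; apply: hh; rewrite ltnS descents_le.
  apply: eq_bigr => l _; have [ln|nl] := leqP (2 * l) n; last first.
    by rewrite invg_vanish ?mul0r// nl orbT.
  congr (_ * (_ / _)); apply: eq_bigr => s _.
  apply: (@iter_dif_local (n - 2 * l).+1) => [k kn|]; last by rewrite ltnS descents_le.
  by apply: hh; rewrite addSn subnK in kn.
have comb c h h' : sum_inv n (fun k => 1 * h k + c * h' k) = sum_inv n h + c * sum_inv n h'
    /\ rhs (fun k => 1 * h k + c * h' k) = rhs h + c * rhs h'.
  split.
    rewrite /sum_inv mulr_sumr -big_split /=.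
    by apply: eq_bigr => s _; rewrite mul1r.
  rewrite /rhs mulr_sumr -big_split /=; apply: eq_bigr => l _.
  rewrite (eq_eulerE _ (iter_dif_comb _ _ _ _ _)) eulerED !eulerEZ; ring.
have basis m : sum_inv n (psi n m) = rhs (psi n m).
  rewrite /sum_inv /psi -natr_sum -/(labelled_count n m) labelled_count_invg.
  apply: eq_bigr => l _; have [ln|nl] := leqP n (2 * l).
    by rewrite invg_vanish ?mul0r// n0 ln.
  rewrite (eq_eulerE _ (iter_dif_psi m nl)) /eulerE /psi.
  by rewrite worpitzky.
(* Triangular elimination: up to [n + 1], [psi n j] is 1 at [j] and 0 beyond, so subtracting [h j]
   times it shortens the support of [h] from the right. *)
suff main j : (j <= n.+2)%N -> forall h, (forall k, (j <= k <= n.+1)%N -> h k = 0) ->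
    sum_inv n h = rhs h.
  by apply: (main n.+2) => // k; lia.
elim: j => [_ h h0|j IH jn h h0].
  have [-> ->] := local h (fun=> 0) (fun k kn => h0 k kn).
  rewrite /sum_inv big1// /rhs big1// => l _.
  by rewrite (eq_eulerE _ (iter_dif_0 _ _)) ?eulerE_cst ?mulr0.
pose h' k := 1 * h k + (- h j) * psi n j k.
have h'0 k : (j <= k <= n.+1)%N -> h' k = 0.
  move=> /andP[jk kn]; rewrite /h' /psi.
  case: (ltngtP j k) jk => // [jk|<-] _.
    by rewrite bin_small ?mulr0 ?h0 ?mulr0 ?addr0//; lia.
  by rewrite addKn binn; ring.
have [c1 c2] := comb (- h j) h (psi n j).
by have := IH (ltnW jn) h' h'0; rewrite c1 c2 basis => /addIr.
Qed.

Lemma sum_inv_cst n : (0 < n)%N -> #|involutions n|%:R = invg n 0.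
Proof.
move=> n0; have := sum_inv_expand (fun=> 1) n0.
rewrite /sum_inv sumr_const => ->; rewrite big_ord_recl muln0 subn0 [iter 0 _ _]/=.
rewrite eulerE_cst mulr1 big1 ?addr0// => l _.
rewrite (@eq_eulerE _ _ _ (fun=> 0)) ?eulerE_cst ?mulr0// => k.
rewrite lift0 mulnS addSn iterSr; apply: iter_dif_0 => i.
by rewrite /dif subrr.
Qed.

Lemma iter_dif_shift f c k j :
  (forall k, dif f k = c) -> iter j.+2 dif f k = 0.
Proof.
move=> fc; elim: j k => [|j IH] k; first by rewrite /= {1}/dif !fc subrr.
by rewrite iterS {1}/dif !IH subrr.
Qed.

(** Second differences kill affine functions, so the mean is exactly the Eulerian one; for a square,
    only the correction [l = 1] survives. *)
Lemma sum_inv_mean n : (0 < n)%N ->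
  sum_inv n (fun d => d%:R) = #|involutions n|%:R * (n.+1%:R / 2).
Proof.
move=> n0; rewrite sum_inv_expand// big_ord_recl muln0 subn0 [iter 0 _ _]/= eulerE_mean//.
rewrite sum_inv_cst// big1 ?addr0// => l _.
rewrite (@eq_eulerE _ _ _ (fun=> 0)) ?eulerE_cst ?mulr0// => k.
rewrite lift0 mulnS; apply: (@iter_dif_shift _ (-1)) => i.
by rewrite /dif -[i.+1%:R]natr1; ring.
Qed.

Lemma sum_inv_second_moment n : (1 < n)%N ->
  sum_inv n (fun d => (d%:R - n.+1%:R / 2) ^+ 2) =
    #|involutions n|%:R * (n.+1%:R / 12) + 2 * invg n 1.
Proof.
move=> n1; have n0 := ltnW n1; rewrite sum_inv_expand// big_ord_recl muln0 subn0.
rewrite [iter 0 _ _]/= eulerE_var// sum_inv_cst//; congr (_ + _).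
case: n n1 {n0} => // n n1; rewrite big_ord_recl big1 ?addr0 => [|l _].
  rewrite lift0 mulrC; congr (_ * _).
  rewrite -[RHS](eulerE_cst (n.+1 - 2 * 1) (2 : R)); apply: eq_eulerE => k.
  by rewrite muln1 /= /dif -[k.+2%:R]natr1 -[k.+1%:R]natr1; field.
rewrite (@eq_eulerE _ _ _ (fun=> 0)) ?eulerE_cst ?mulr0// => k.
rewrite !lift0 !mulnS addnA addSn iterSr.
apply: (@iter_dif_shift _ 2) => i.
by rewrite /dif -[i.+2%:R]natr1 -[i.+1%:R]natr1; ring.
Qed.

End Involutions.

Lemma sum_exp_le (R : realType) (x : R) N : 0 <= x ->
  \sum_(l < N) x ^+ l / l`!%:R <= expR x.
Proof.
move=> x0; have := @nondecreasing_cvgn_le R (series (exp_coeff x)) _ _ N.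
rewrite /series /= big_mkord; apply; last exact: is_cvg_series_exp_coeff.
apply/nondecreasing_seqP => i; rewrite /= big_nat_recr//= lerDl.
by rewrite /exp_coeff /= divr_ge0// exprn_ge0.
Qed.

(** * The distribution function on involutions *)

Section InvolutionsCdf.
Variable R : realType.
Implicit Types (y : R) (n r l : nat).

Definition ind y (k : nat) : R := (k%:R <= y)%R%:R.

Lemma dif_ind y k : dif (ind y) k = 1 * ind y k + -1 * ind (y - 1) k.
Proof. by rewrite /dif /ind -[k.+1%:R]natr1 -lerBrDr; ring. Qed.

(** The first difference of an indicator gives a point mass; each further one subtracts two such
    quantities at levels one apart and at most doubles the bound. *)
Lemma eulerE_iter_dif_ind N r y :
  `|eulerE N (iter r.+1 (@dif R) (ind y))| <= 2 ^+ r * (pmf_const R / Num.sqrt N.+1%:R).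
Proof.
elim: r y => [|r IH] y.
  rewrite (eq_eulerE _ (dif_ind y)) eulerED !eulerEZ !mul1r mulN1r.
  rewrite ger0_norm; first exact: eulerF_increment.
  by rewrite subr_ge0; apply: eulerF_homo; rewrite gerBl.
rewrite iterSr; have -> : dif (ind y) = (fun k => 1 * ind y k + -1 * ind (y - 1) k).
  by apply/funext => k; exact: dif_ind.
rewrite (eq_eulerE _ (iter_dif_comb _ _ _ _ _)) eulerED !eulerEZ mul1r mulN1r.
apply: (le_trans (ler_normB _ _)).
by rewrite exprS -mulrA mulr_natl mulr2n lerD.
Qed.

Definition invF n y : R := sum_inv n (ind y) / #|involutions n|%:R.

Lemma card_involutions_gt0 n : (0 < #|involutions n|)%N.
Proof. by apply/card_gt0P; exists 1%g; rewrite inE expg1n. Qed.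

Lemma invF_close n y : (0 < n)%N ->
  `|invF n y - eulerF n y| <= pmf_const R * expR 4 / Num.sqrt n.+1%:R.
Proof.
move=> n0; have I0 : 0 < #|involutions n|%:R :> R by rewrite ltr0n card_involutions_gt0.
have p0 : 0 < pmf_const R by rewrite /pmf_const; have := be_const_ge R; lra.
rewrite /invF sum_inv_expand// big_ord_recl muln0 subn0 [iter 0 _ _]/= mulrDl.
rewrite -(sum_inv_cst R n0) mulrAC divff ?gt_eqF// mul1r addrC addKr.
rewrite normrM [X in _ * X]gtr0_norm ?invr_gt0// ler_pdivrMr//.
apply: (le_trans (ler_norm_sum _ _ _)).
have c0 : 0 <= pmf_const R / Num.sqrt n.+1%:R * #|involutions n|%:R.
  by rewrite mulr_ge0 ?(ltW I0)// divr_ge0 ?sqrtr_ge0 ?(ltW p0).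
apply: (@le_trans _ _ (\sum_(l < n) (4 ^+ l.+1 / l.+1`!%:R) *
    (pmf_const R / Num.sqrt n.+1%:R * #|involutions n|%:R))).
  apply: ler_sum => l _; rewrite lift0.
  have [ln|nl] := leqP (2 * l.+1) n; last first.
    by rewrite invg_vanish ?nl ?orbT// mul0r normr0 mulr_ge0// divr_ge0// exprn_ge0.
  rewrite normrM ger0_norm ?invg_ge0//.
  set L := l.+1 in ln *; set N := (n - 2 * L)%N.
  have h1 := eulerE_iter_dif_ind N (2 * l).+1 y.
  have h2 := invg_bound R n L; rewrite -(sum_inv_cst R n0) in h2.
  (* Replacing [N] by [n] costs [2 ^ L], because [n + 1 <= 4 ^ L * (N + 1)]. The [2 ^ L] of
     [invg_bound] pays for it, and the differences leave [4 ^ L / L!], with sum at most [expR 4]. *)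
  have h3 : (Num.sqrt N.+1%:R)^-1 <= 2 ^+ L / Num.sqrt n.+1%:R :> R.
    rewrite ler_pdivlMr ?sqrtr_gt0// mulrC ler_pdivrMr ?sqrtr_gt0//.
    rewrite -[2 ^+ L](@ger0_norm R) ?exprn_ge0// -sqrtr_sqr -sqrtrM ?sqr_ge0//.
    have -> : (2 ^+ L) ^+ 2 = (4 ^ L)%:R :> R by rewrite -exprM mulnC exprM -!natrX.
    rewrite ler_wsqrtr// -natrM ler_nat.
    have : (2 * L < 4 ^ L)%N by elim: (L) => // k IH; rewrite expnS; lia.
    by rewrite /N; nia.
  have -> : (2 * L = (2 * l).+2)%N by rewrite /L; lia.
  have i0 := invg_ge0 R n L.
  apply: (le_trans (ler_wpM2l i0 h1)).
  have f0 : 0 < (2 ^ L * L`!)%:R :> R by rewrite ltr0n muln_gt0 expn_gt0 fact_gt0.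
  rewrite -(ler_pM2l f0) mulrA.
  apply: (le_trans (ler_wpM2r _ h2)).
    by rewrite mulr_ge0 ?exprn_ge0// mulr_ge0 ?invr_ge0 ?sqrtr_ge0// ltW.
  have e1 : 2 ^+ (2 * l).+1 <= 4 ^+ L :> R.
    by rewrite -!natrX ler_nat /L -[4%N]/(2 ^ 2)%N -expnM leq_exp2l//; lia.
  have p1 : 2 ^+ (2 * l).+1 * (pmf_const R / Num.sqrt N.+1%:R) <=
      4 ^+ L * (pmf_const R * (2 ^+ L / Num.sqrt n.+1%:R)).
    rewrite ler_pM ?exprn_ge0//; first by rewrite divr_ge0 ?sqrtr_ge0// ltW.
    by rewrite ler_pM2l.
  apply: (le_trans (ler_wpM2l (ltW I0) p1)).
  rewrite natrM natrX le_eqVlt; apply/orP; left; apply/eqP; field.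
  by rewrite fact_neq0 gt_eqF// sqrtr_gt0.
rewrite -mulr_suml [leRHS](_ : _ =
  expR 4 * (pmf_const R / Num.sqrt n.+1%:R * #|involutions n|%:R)); last by ring.
rewrite ler_wpM2r//; apply: le_trans (@sum_exp_le R 4 n.+1 _) => //.
by rewrite big_ord_recl lerDr divr_ge0.
Qed.

End InvolutionsCdf.

(** * Derangements: inclusion-exclusion over fixed points *)

Section Derangements.
Variable R : realType.
Implicit Types (f g : nat -> R) (n k : nat).

Definition fixsum n (S : {set 'I_n}) f : R :=
  \sum_(s : 'S_n | [forall i in S, s i == i]) f #|descents s|.+1.

Definition fixed_restrict n (i : 'I_n.+1) (S : {set 'I_n.+1}) : {set 'I_n} :=
  [set j | lift i j \in S].

Lemma card_fixed_restrict n (i : 'I_n.+1) (S : {set 'I_n.+1}) : i \in S ->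
  #|S| = #|fixed_restrict i S|.+1.
Proof.
move=> iS; rewrite (cardsD1 i) iS add1n -(card_imset _ (@lift_inj _ i)); congr _.+1.
apply: eq_card => j; rewrite !inE; apply/andP/imsetP.
  case=> ji jS; case: (unliftP i j) ji => [j' jE|->]; last by rewrite eqxx.
  by exists j' => //; rewrite inE -jE.
by case=> j'; rewrite inE => j'S ->; rewrite j'S eq_sym neq_lift.
Qed.

Lemma fixsum_lift n (i : 'I_n.+1) (S : {set 'I_n.+1}) f : i \in S ->
  fixsum S f = \sum_(s : 'S_n | [forall j in fixed_restrict i S, s j == j])
    f #|descents (lift_perm i i s)|.+1.
Proof.
move=> iS; rewrite /fixsum big_mkcond (sum_lift_perm i) (bigD1 i)//= [X in _ + X]big1 ?addr0.
  rewrite [RHS]big_mkcond; apply: eq_bigr => s _; congr (if _ then _ else _).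
  apply/forall_inP/forall_inP => [H j|H j jS].
    by rewrite inE => /H; rewrite lift_perm_lift (inj_eq lift_inj).
  case: (unliftP i j) => [j' jE|->]; last by rewrite lift_perm_id.
  by rewrite jE lift_perm_lift (inj_eq lift_inj) H// inE -jE.
move=> i' i'i; rewrite big1// => s _; case: ifP => // /forall_inP /(_ i iS) /eqP si.
by case/eqP: i'i; apply: (@perm_inj _ (lift_perm i' i s)); rewrite lift_perm_id si.
Qed.

(* Deleting the k fixed points changes the number of descents by at most k. *)
Lemma fixsum_le n (S : {set 'I_n}) f g :
  (forall x y, (x <= y + #|S|)%N -> (y <= x + #|S|)%N -> f x <= g y) ->
  fixsum S f <= (n - #|S|)`!%:R * eulerE n g.
Proof.
elim: n S f g => [|n IH] S f g fg.
  have S0 : #|S| = 0%N by apply: eq_card0 => -[].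
  rewrite S0 subn0 /eulerE divr1 mul1r /fixsum /sum_des big_mkcond.
  apply: ler_sum => s _; case: ifP => [_|/negP[]]; first by apply: fg; rewrite S0 addn0.
  by apply/forall_inP => -[].
have le_full : forall h : nat -> R, (forall d, h d <= g d) ->
    fixsum (finset.set0 : {set 'I_n.+1}) h <= n.+1`!%:R * eulerE n.+1 g.
  move=> h hg; rewrite /eulerE mulrC divfK ?fact_neq0// /fixsum /sum_des big_mkcond.
  apply: ler_sum => s _; case: ifP => [_|/negP[]]; first exact: hg.
  by apply/forall_inP => j; rewrite inE.
have [S0|[i iS]] := set_0Vmem S.
  by rewrite S0 cards0 subn0; apply: le_full => d; apply: fg; rewrite S0 cards0 addn0.
rewrite (fixsum_lift _ iS) (card_fixed_restrict iS) subSS.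
set S' := fixed_restrict i S; rewrite (card_fixed_restrict iS) -/S' in fg.
(* Deleting the fixed point lowers D by 0 or 1, and so does passing from [S_(n+1)] to [S_n] in the
   Eulerian law. Both moves go the same way, so the tolerance changes by one only. *)
pose f' x := Num.max (f x) (f x.+1); pose g' y := Num.min (g y) (g y.+1).
apply: (@le_trans _ _ (fixsum S' f')).
  apply: ler_sum => s _; rewrite /f' le_max.
  have := desw_lift_perm i i s; rewrite leq_eqVlt => /andP[/orP[/eqP <-|h1] h2].
    by rewrite lexx.
  by have -> : #|descents (lift_perm i i s)| = #|descents s|.+1; [lia|rewrite lexx orbT].
apply: (@le_trans _ _ ((n - #|S'|)`!%:R * eulerE n g')).
  by apply: IH => x y xy yx; rewrite /f' /g' ge_max !le_min !fg//; lia.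
rewrite ler_wpM2l//; apply: eulerE_le_succ => d; rewrite /g' ge_min lexx ?orbT//.
Qed.

Lemma fixsum_ge n (S : {set 'I_n}) f g :
  (forall x y, (x <= y + #|S|)%N -> (y <= x + #|S|)%N -> g y <= f x) ->
  (n - #|S|)`!%:R * eulerE n g <= fixsum S f.
Proof.
move=> gf; have := @fixsum_le n S (fun x => - f x) (fun y => -1 * g y).
rewrite eulerEZ mulN1r mulrN /fixsum sumrN lerN2; apply => x y xy yx.
by rewrite mulN1r lerN2 gf.
Qed.

Definition der_sum n f : R := \sum_(s in derangements n) f #|descents s|.+1.

(** The indicator of a derangement is the product over [i] of [1 - [s i = i]], expanded over
    subsets. *)
Lemma der_sum_fixsum n f : der_sum n f = \sum_(S : {set 'I_n}) (-1) ^+ #|S| * fixsum S f.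
Proof.
rewrite /der_sum big_mkcond /=.
under [RHS]eq_bigr => S _ do rewrite /fixsum mulr_sumr big_mkcond.
rewrite exchange_big /=; apply: eq_bigr => s _.
transitivity (f #|descents s|.+1 * \prod_(i < n) (- (s i == i)%:R + 1)).
  rewrite inE; case: ifP => [/forallP sd|/negbT].
    by rewrite big1 ?mulr1// => i _; rewrite (negbTE (sd i)) oppr0 add0r.
  rewrite negb_forall => /existsP[i]; rewrite negbK => si.
  by rewrite (bigD1 i)//= si addNr mul0r mulr0.
rewrite bigA_distr mulr_sumr; apply: eq_bigr => S _.
rewrite -big_mkcond /= prodrN; case: ifP => [/forall_inP H|/negbT].
  have -> : \prod_(i in S) (s i == i)%:R = 1 :> R by apply: big1 => i /H ->.
  by rewrite mulr1 mulrC.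
rewrite negb_forall => /existsP[i]; rewrite negb_imply => /andP[iS si].
by rewrite (bigD1 i)//= (negbTE si) mul0r !mulr0.
Qed.

Lemma sum_by_card n (h : nat -> R) :
  \sum_(S : {set 'I_n}) h #|S| = \sum_(k < n.+1) 'C(n, k)%:R * h k.
Proof.
have cS (S : {set 'I_n}) : (#|S| < n.+1)%N by rewrite ltnS -[n in (_ <= n)%N]card_ord max_card.
rewrite (partition_big (fun S : {set 'I_n} => Ordinal (cS S)) xpredT)//=.
apply: eq_bigr => k _; rewrite (eq_bigr (fun=> h k)); last first.
  by move=> S /eqP /(congr1 val) /= ->.
rewrite sumr_const mulr_natl; congr (_ *+ _).
rewrite -[X in 'C(X, _)](card_ord n) -card_draws; apply: eq_card => S.
by rewrite !inE.
Qed.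

Lemma sum_by_card_fact n (h : nat -> R) :
  \sum_(S : {set 'I_n}) (n - #|S|)`!%:R * h #|S| =
  n`!%:R * \sum_(k < n.+1) h k / k`!%:R.
Proof.
rewrite (sum_by_card n (fun k => (n - k)`!%:R * h k)) mulr_sumr; apply: eq_bigr => k _.
have kn : (k <= n)%N by rewrite -ltnS.
have := bin_fact kn => /(congr1 (fun i => i%:R : R)); rewrite !natrM => <-.
by field; rewrite fact_neq0.
Qed.

Definition alt n : R := \sum_(k < n.+1) (-1) ^+ k / k`!%:R.

Lemma fixsum1 n (S : {set 'I_n}) : fixsum S (fun=> 1) = (n - #|S|)`!%:R.
Proof.
apply/le_anti/andP; split.
  by rewrite -[leRHS]mulr1 -[X in _ <= _ * X](eulerE_cst n (1 : R)); apply: fixsum_le.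
by rewrite -[leLHS]mulr1 -[X in _ * X <= _](eulerE_cst n (1 : R)); apply: fixsum_ge.
Qed.

Lemma card_derangements n : #|derangements n|%:R = n`!%:R * alt n.
Proof.
have := der_sum_fixsum n (fun=> 1); rewrite /der_sum sumr_const => ->.
rewrite -sum_by_card_fact; apply: eq_bigr => S _.
by rewrite fixsum1 mulrC.
Qed.

Lemma alt_ge n : (1 < n)%N -> 3^-1 <= alt n.
Proof.
have altS k : alt k.+1 = alt k + (-1) ^+ k.+1 / k.+1`!%:R.
  by rewrite /alt big_ord_recr.
have alt2 : alt 2 = 2^-1.
  by rewrite /alt !big_ord_recr big_ord0 /= !factS fact0 !muln1 expr0 expr1 sqrrN expr1n; field.
case: n => [|[|n]] // _.
(* Two consecutive bounds are carried along: a positive new term adds to the last sum, a negative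
   one is offset by the larger positive term before it. *)
suff [] : 3^-1 <= alt n.+2 /\ 3^-1 <= alt n.+3 by [].
elim: n => [|n [IH1 IH2]].
  rewrite (altS 2%N) alt2 exprS sqrrN expr1n mulr1; split; first lra.
  by rewrite (_ : 3`! = 6)%N//; lra.
split=> //; have := altS n.+3; have := altS n.+2.
rewrite [(-1) ^+ n.+4]exprS -signr_odd; case: odd => /= e1 e2; last first.
  rewrite expr0 mulr1 in e1 e2.
  have f0 : (n.+4`!%:R)^-1 <= (n.+3`!%:R)^-1 :> R.
    by rewrite lef_pV2 ?posrE ?ltr0n ?fact_gt0// ler_nat leq_fact.
  by rewrite e2 e1; lra.
rewrite expr1 mulrNN mulr1 in e1 e2.
have f0 : 0 <= (n.+4`!%:R)^-1 :> R by rewrite invr_ge0.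
by rewrite e2; lra.
Qed.

Lemma sum_sqr_fact_le N : \sum_(k < N) (k%:R ^+ 2 / k`!%:R) <= 6 :> R.
Proof.
(* The subtracted [(N + 2) / (N - 1)!] bounds the rest of the series and lets the induction close;
   it decreases fast enough from [N = 3] on. *)
suff [|] : (N <= 2)%N \/ \sum_(k < N) (k%:R ^+ 2 / k`!%:R) <= 6 - (N%:R + 2) / N.-1`!%:R :> R.
- case: N => [|[|[|]]] // _; rewrite ?big_ord_recr big_ord0 /= ?expr0n ?expr1n ?mul0r /=.
  + lra.
  + lra.
  + by rewrite factS fact0 muln1; lra.
- by move=> /le_trans; apply; rewrite gerBl divr_ge0// addr_ge0.
have base : \sum_(k < 3) (k%:R ^+ 2 / k`!%:R) <= 6 - (3%:R + 2) / 2`!%:R :> R.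
  rewrite !big_ord_recr big_ord0 /= expr0n expr1n !factS fact0 !muln1 expr2 /=; lra.
elim: N => [|N [N2|IH]]; first by left.
  case: (ltnP N 2) => [|N2']; first by left.
  by right; have -> : N = 2%N by lia.
case: N IH => [|[|[|N]]] IH; [by left|by left|by right; exact: base|right].
rewrite big_ord_recr /= -lerBrDr; apply: (le_trans IH); rewrite -subr_ge0.
have F0 : 0 < N.+2`!%:R :> R by rewrite ltr0n fact_gt0.
have -> : N.+3`!%:R = N.+3%:R * N.+2`!%:R :> R by rewrite factS natrM.
rewrite [X in 0 <= X](_ : _ = N%:R / (N.+3%:R * N.+2`!%:R)); first by rewrite divr_ge0 ?mulr_ge0.
rewrite -[N.+4%:R]natr1 -[N.+3%:R]natr1 -[N.+2%:R]natr1 -[N.+1%:R]natr1; field.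
by rewrite gt_eqF//= !natr1 -?natr1 -?natrD ?pnatr_eq0.
Qed.

(** Errors of relative size [k^2] over the sets of [k] points add up to at most [6 n!] times [b],
    and at least a third of all permutations are derangements: [18 = 6 * 3]. *)
Lemma der_sum_close n f (A b : R) : (1 < n)%N ->
  (forall S : {set 'I_n}, `|fixsum S f - (n - #|S|)`!%:R * A|
     <= (n - #|S|)`!%:R * (#|S|%:R ^+ 2 * b)) -> 0 <= b ->
  `|der_sum n f / #|derangements n|%:R - A| <= 18 * b.
Proof.
move=> n1 fS b0; have an := alt_ge n1.
have F0 : 0 < n`!%:R :> R by rewrite ltr0n fact_gt0.
have d0 : 0 < #|derangements n|%:R :> R by rewrite card_derangements mulr_gt0//; lra.
have dE : der_sum n f - A * #|derangements n|%:R =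
    \sum_(S : {set 'I_n}) (-1) ^+ #|S| * (fixsum S f - (n - #|S|)`!%:R * A).
  rewrite der_sum_fixsum card_derangements -sum_by_card_fact mulr_sumr -sumrB.
  by apply: eq_bigr => S _; ring.
rewrite -(ler_pM2r d0) -[X in _ * X <= _](gtr0_norm d0) -normrM mulrBl divfK ?gt_eqF// dE.
apply: (le_trans (ler_norm_sum _ _ _)).
apply: (@le_trans _ _ (\sum_(S : {set 'I_n}) (n - #|S|)`!%:R * (#|S|%:R ^+ 2 * b))).
  by apply: ler_sum => S _; rewrite normrM normr_sign mul1r.
rewrite (sum_by_card_fact n (fun k => k%:R ^+ 2 * b)) card_derangements.
have -> : \sum_(k < n.+1) k%:R ^+ 2 * b / k`!%:R = b * \sum_(k < n.+1) (k%:R ^+ 2 / k`!%:R).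
  by rewrite mulr_sumr; apply: eq_bigr => k _; ring.
have := sum_sqr_fact_le n.+1; set Q := \sum_(_ < _) _ => Q6.
rewrite [leRHS]mulrCA ler_pM2l//.
have := ler_wpM2l b0 Q6; have := ler_wpM2l b0 an; lra.
Qed.

Lemma eulerF_shift n k (y : R) :
  eulerF n (y + k%:R) - eulerF n y <= k%:R * (pmf_const R / Num.sqrt n.+1%:R).
Proof.
elim: k => [|k IH]; first by rewrite addr0 subrr mul0r.
have := eulerF_increment n (y + k.+1%:R); move: IH; move: (pmf_const R / _) => c.
rewrite (_ : y + k.+1%:R - 1 = y + k%:R); last by rewrite -natr1; ring.
rewrite (_ : k.+1%:R * c = k%:R * c + c); last by rewrite -natr1; ring.
lra.
Qed.

Lemma natr_le_sqr k : k%:R <= k%:R ^+ 2 :> R.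
Proof. by rewrite -natrX ler_nat; case: k => // k; rewrite expnS expn1 leq_pmulr. Qed.

Definition derF n (y : R) : R := der_sum n (ind y) / #|derangements n|%:R.

Lemma derF_close n (y : R) : (1 < n)%N ->
  `|derF n y - eulerF n y| <= 18 * (pmf_const R / Num.sqrt n.+1%:R).
Proof.
move=> n1; have b0 : 0 <= pmf_const R / Num.sqrt n.+1%:R.
  by rewrite divr_ge0 ?sqrtr_ge0// /pmf_const; have := be_const_ge R; lra.
apply: der_sum_close => // S; set k := #|S|; set F := (n - k)`!%:R.
have F0 : 0 <= F by [].
have kb : k%:R * (pmf_const R / Num.sqrt n.+1%:R) <= k%:R ^+ 2 * (pmf_const R / Num.sqrt n.+1%:R).
  by rewrite ler_wpM2r// natr_le_sqr.
have up : fixsum S (ind y) <= F * eulerF n (y + k%:R).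
  apply: fixsum_le => x x' _ xx'; rewrite /ind ler_nat.
  case: (leP (x%:R : R) y) => // xy; rewrite (_ : (x'%:R <= y + k%:R)%R = true)//.
  by apply: le_trans (_ : x%:R + k%:R <= _); rewrite ?lerD2r// -natrD ler_nat.
have lo : F * eulerF n (y - k%:R) <= fixsum S (ind y).
  apply: fixsum_ge => x x' xx' _; rewrite /ind ler_nat.
  case: (leP (x'%:R : R) (y - k%:R)) => // xy; rewrite (_ : (x%:R <= y)%R = true)//.
  by move: xy; rewrite lerBrDr; apply: le_trans; rewrite -natrD ler_nat.
have s1 := eulerF_shift n k y; have := eulerF_shift n k (y - k%:R); rewrite subrK => s2.
have := ler_wpM2l F0 (le_trans s1 kb); have := ler_wpM2l F0 (le_trans s2 kb).
by rewrite ler_norml => *; apply/andP; split; lra.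
Qed.

Lemma der_mean_close n : (1 < n)%N ->
  `|der_sum n (fun d => d%:R) / #|derangements n|%:R - n.+1%:R / 2| <= 18.
Proof.
move=> n1; rewrite -[leRHS]mulr1; apply: der_sum_close => // S.
set k := #|S|; set F := (n - k)`!%:R; have F0 : 0 <= F by [].
have kk := natr_le_sqr k; have mE := eulerE_mean R (ltnW n1).
have up : fixsum S (fun d => d%:R) <= F * (n.+1%:R / 2 + k%:R).
  rewrite -mE -[X in _ + X](eulerE_cst n k%:R) -eulerED; apply: fixsum_le => x x' xx' _.
  by rewrite -natrD ler_nat.
have lo : F * (n.+1%:R / 2 + - k%:R) <= fixsum S (fun d => d%:R).
  rewrite -mE -[X in _ + X](eulerE_cst n (- k%:R)) -eulerED; apply: fixsum_ge => x x' _ xx'.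
  by rewrite lerBlDr -natrD ler_nat.
have := ler_wpM2l F0 kk.
by rewrite ler_norml => *; apply/andP; split; lra.
Qed.

Lemma der_second_moment_close n : (1 < n)%N ->
  `|der_sum n (fun d => (d%:R - n.+1%:R / 2) ^+ 2) / #|derangements n|%:R - n.+1%:R / 12|
    <= 18 * (3 * Num.sqrt n.+1%:R).
Proof.
move=> n1; set r := Num.sqrt _; have r0 : 0 < r by rewrite sqrtr_gt0.
have rr : r * r = n.+1%:R by rewrite -expr2 sqr_sqrtr.
have r1 : 1 <= r by rewrite -[leLHS]sqrtr1 ler_wsqrtr// ler1n.
apply: der_sum_close => // [S|]; last by rewrite mulr_ge0// ltW.
set k := #|S|; set F := (n - k)`!%:R; have F0 : 0 <= F by [].
set m := n.+1%:R / 2; pose q d : R := (d%:R - m) ^+ 2.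
have kk := natr_le_sqr k; have vE : eulerE n q = r * r / 12 by rewrite rr eulerE_var.
have k0 : 0 <= k%:R :> R by [].
pose c : R := k%:R * r + k%:R ^+ 2.
(* The cross term of the square is split by [2 |u| <= u^2 / r + r], with [r] of the order of the
   standard deviation, so that both parts have a mean of order [r]. *)
have near x x' : (x <= x' + k)%N -> (x' <= x + k)%N ->
    `|q x - q x'| <= (k%:R / r) * q x' + c.
  rewrite -(ler_nat R) -(ler_nat R) !natrD /q /c => h1 h2.
  set u := x'%:R - m; have -> : x%:R - m = u + (x%:R - x'%:R) by rewrite /u; ring.
  set e := x%:R - x'%:R; have ek : `|e| <= k%:R by rewrite ler_norml /e; apply/andP; split; lra.
  rewrite (_ : (u + e) ^+ 2 - u ^+ 2 = 2 * u * e + e ^+ 2); last by ring.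
  apply: (le_trans (ler_normD _ _)); rewrite addrA lerD//; last first.
    by rewrite normrX ler_pXn2r ?nnegrE.
  rewrite !normrM (@ger0_norm _ 2)//.
  apply: (@le_trans _ _ (2 * `|u| * k%:R)); first by rewrite ler_wpM2l// mulr_ge0.
  have ur : 2 * `|u| <= u ^+ 2 / r + r.
    have : 0 <= (`|u| - r) ^+ 2 / r by rewrite divr_ge0 ?sqr_ge0// ltW.
    rewrite sqrrB real_normK ?num_real// (_ : _ / r = u ^+ 2 / r - 2 * `|u| + r); first lra.
    by rewrite -mulr_natr; field; rewrite gt_eqF.
  have := ler_wpM2r k0 ur.
  by rewrite (_ : (u ^+ 2 / r + r) * k%:R = k%:R / r * u ^+ 2 + k%:R * r)//; ring.
have rne : r != 0 by rewrite gt_eqF.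
have up : fixsum S q <= F * ((1 + k%:R / r) * (r * r / 12) + c).
  rewrite -vE -eulerEZ -[c](eulerE_cst n c) -eulerED; apply: fixsum_le => x x' h1 h2.
  have := near x x' h1 h2; rewrite ler_norml => /andP[_]; lra.
have lo : F * ((1 - k%:R / r) * (r * r / 12) + - c) <= fixsum S q.
  rewrite -vE -eulerEZ -[- c](eulerE_cst n (- c)) -eulerED; apply: fixsum_ge => x x' h1 h2.
  have := near x x' h1 h2; rewrite ler_norml => /andP[+ _]; lra.
rewrite -rr; have kr : k%:R / r * (r * r / 12) = k%:R * r / 12 by field.
have k2r : k%:R * r <= k%:R ^+ 2 * r by rewrite ler_wpM2r// ltW.
have k2r' : k%:R ^+ 2 <= k%:R ^+ 2 * r by rewrite ler_peMr.
have cb : k%:R * r / 12 + c <= k%:R ^+ 2 * (3 * r) by rewrite /c; lra.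
have := ler_wpM2l F0 cb; rewrite !mulrDl !mulNr !mul1r kr in up lo *.
by rewrite ler_norml => *; apply/andP; split; lra.
Qed.

End Derangements.

(** * From averages over a set of permutations to standardized distribution functions *)

Section Transfer.
Variables (R : realType) (n : nat) (A : {set 'S_n}).
Hypothesis A0 : A != finset.set0.
Implicit Types (f g : 'S_n -> R).

Definition avg f : R := (\sum_(s in A) f s) / #|A|%:R.

Lemma avg_card_neq0 : #|A|%:R != 0 :> R.
Proof. by rewrite pnatr_eq0 cards_eq0. Qed.

Lemma expectation_uniform_on f : ('E_(uniform_on R A)[f] = (avg f)%:E)%E.
Proof.
have in1 (w s : 'S_n) : (w \in [set s]%classic) = (w == s).
  by apply/idP/eqP => [/set_mem|->]; last exact/mem_set.
have fE (w : 'S_n) : (f w)%:E = (\sum_s (f s)%:E * (\1_([set s]%classic) w)%:E)%E.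
  rewrite (bigD1 w)//= big1 ?adde0; first by rewrite indicE in1 eqxx mule1.
  by move=> s sw; rewrite indicE in1 eq_sym (negbTE sw) mule0.
have int1 (s : 'S_n) : (uniform_on R A).-integrable [set: 'S_n]%classic
    (fun w => (\1_([set s]%classic) w : R)%:E) by exact: integrable_indic.
have mass (s : 'S_n) :
    uniform_on R A [set s]%classic = ((s \in A)%:R / #|A|%:R)%:E.
  rewrite uniform_onE//; congr (_%:R / _)%:E.
  rewrite (_ : [set _ in A | _] = if s \in A then [set s] else finset.set0).
    by case: ifP => _; rewrite (cards1, cards0).
  apply/setP => t; rewrite !inE; case: ifPn => sA.
    rewrite finset.in_set1; apply/andP/eqP => [[_ /asboolP]//|->]; split => //.
    exact/asboolP.
  rewrite finset.in_set0; apply/negbTE/negP => /andP[tA /asboolP ts].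
  by rewrite -ts tA in sA.
rewrite unlock; under eq_integral do rewrite fE.
rewrite integral_sum//; last by move=> s; exact: integrableZl.
transitivity (\sum_s ((f s)%:E * ((s \in A)%:R / #|A|%:R)%:E))%E.
  apply: eq_bigr => s _; rewrite integralZl// integral_indic// setIT.
  by congr (_ * _)%E; exact: mass.
rewrite sumEFin /avg big_distrl /= [in RHS]big_mkcond /=; congr (_%:E).
apply: eq_bigr => s _; case: ifP => _; first by rewrite mul1r.
by rewrite mul0r mulr0.
Qed.

Lemma variance_uniform_on f :
  ('V_(uniform_on R A)[f] = (avg (fun s => (f s - avg f) ^+ 2)%R)%:E)%E.
Proof.
rewrite /variance unlock expectation_uniform_on /=.
by rewrite expectation_uniform_on.
Qed.

Lemma avg_sqr_shift f c :
  avg (fun s => (f s - avg f) ^+ 2) = avg (fun s => (f s - c) ^+ 2) - (avg f - c) ^+ 2.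
Proof.
have sqE d : \sum_(s in A) (f s - d) ^+ 2 =
    \sum_(s in A) f s ^+ 2 - 2 * d * \sum_(s in A) f s + #|A|%:R * d ^+ 2.
  have sqB (y : R) : (y - d) ^+ 2 = y ^+ 2 - 2 * d * y + d ^+ 2 by ring.
  under eq_bigr => s _ do rewrite sqB.
  by rewrite big_split /= sumrB sumr_const -mulr_sumr -(mulr_natl _ #|A|).
by rewrite /avg !sqE; field; exact: avg_card_neq0.
Qed.

Lemma standardized_cdf_uniform_on f x :
  0 < avg (fun s => (f s - avg f) ^+ 2) ->
  standardized_cdf (uniform_on R A) f x =
  avg (fun s => (f s <= avg f + Num.sqrt (avg (fun s => (f s - avg f) ^+ 2)) * x)%R%:R).
Proof.
move=> v0; rewrite /standardized_cdf expectation_uniform_on variance_uniform_on /=.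
rewrite uniform_onE//= /avg -/(avg f) -/(avg (fun s => (f s - avg f) ^+ 2)).
rewrite -natr_sum; congr (_%:R / _).
rewrite -sum1_card big_mkcond [RHS]big_mkcond /=; apply: eq_bigr => s _; rewrite inE.
case: (s \in A) => //=; rewrite asboolb ler_pdivrMr ?sqrtr_gt0// lerBlDl mulrC.
by case: ifP.
Qed.

(** Exchanging the model parameters [mu0], [v0] for [m], [v] costs a translation, bounded by
    [Phi_lipschitz], and a dilation, bounded by [Phi_scale]. *)
Lemma Phi_transfer (G : R -> R) mu0 v0 m v eps x : 0 < v0 -> 0 < v ->
  (forall y, `|G y - Phi ((y - mu0) / Num.sqrt v0)| <= eps) ->
  `|G (m + Num.sqrt v * x) - Phi x| <=
    eps + `|m - mu0| / Num.sqrt v0 + 2 * (`|v - v0| / v0).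
Proof.
move=> v00 v0' Gle.
have s0 : 0 < Num.sqrt v0 by rewrite sqrtr_gt0.
have sv : 0 < Num.sqrt v by rewrite sqrtr_gt0.
set a := Num.sqrt v / Num.sqrt v0.
have a0 : 0 <= a by rewrite divr_ge0 ?ltW.
have shift : `|Phi ((m + Num.sqrt v * x - mu0) / Num.sqrt v0) - Phi (a * x)| <=
    `|m - mu0| / Num.sqrt v0.
  apply: le_trans (Phi_lipschitz _ _) _.
  rewrite (_ : _ - a * x = (m - mu0) / Num.sqrt v0); last by rewrite /a; ring.
  by rewrite normrM normfV (gtr0_norm s0).
(* [|a - 1| <= |a - 1| (a + 1) = |a^2 - 1|] avoids a difference of square roots. *)
have scale : `|a - 1| <= `|v - v0| / v0.
  have aE : (a - 1) * (a + 1) = (v - v0) / v0.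
    rewrite -subr_sqr_1 /a exprMn exprVn !sqr_sqrtr ?ltW//.
    by rewrite mulrBl divff ?gt_eqF.
  have -> : `|v - v0| / v0 = `|(a - 1) * (a + 1)|.
    by rewrite aE normrM normfV (gtr0_norm v00).
  rewrite normrM.
  by rewrite ler_peMr// ger0_norm ?addr_ge0// lerDr.
have scale' : `|Phi (a * x) - Phi x| <= 2 * (`|v - v0| / v0).
  by apply: le_trans (Phi_scale x a0) _; rewrite ler_pM2l.
apply: le_trans (ler_distD (Phi (a * x)) _ _) (lerD _ scale').
apply: le_trans (ler_distD (Phi ((m + Num.sqrt v * x - mu0) / Num.sqrt v0)) _ _) _.
exact: lerD (Gle _) shift.
Qed.

(** The averages are those of D; its shift by one from the number of descents cancels in the
    standardization. Using the second moment about [mu0] in place of the variance costs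
    [(m - mu0) ^+ 2]. *)
Lemma standardized_descents_close mu0 v0 eps x : 0 < v0 ->
  let m := avg (fun s => #|descents s|.+1%:R) in
  let w := avg (fun s => (#|descents s|.+1%:R - mu0) ^+ 2) in
  (forall y, `|avg (fun s => (#|descents s|.+1%:R <= y)%R%:R) -
     Phi ((y - mu0) / Num.sqrt v0)| <= eps) ->
  (0 < 'V_(uniform_on R A)[@ndescents R n])%E ->
  `|standardized_cdf (uniform_on R A) (@ndescents R n) x - Phi x| <=
    eps + `|m - mu0| / Num.sqrt v0 + 2 * ((`|w - v0| + (m - mu0) ^+ 2) / v0).
Proof.
move=> v00 m w close; rewrite variance_uniform_on lte_fin => V0.
set V := avg _ in V0.
have mE : m = avg (@ndescents R n) + 1.
  apply: (mulIf avg_card_neq0); rewrite mulrDl mul1r !mulfVK ?avg_card_neq0//.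
  by rewrite -sumr_const -big_split /=; apply: eq_bigr => s _; rewrite -natr1.
have VE : V = w - (m - mu0) ^+ 2.
  rewrite /V (avg_sqr_shift _ (mu0 - 1)) mE; congr (_ - _ ^+ 2); last by ring.
  congr (_ / _); apply: eq_bigr => s _; rewrite -natr1 /ndescents; ring.
have cdfE : standardized_cdf (uniform_on R A) (@ndescents R n) x =
    avg (fun s => (#|descents s|.+1%:R <= m + Num.sqrt V * x)%R%:R).
  rewrite standardized_cdf_uniform_on//; congr (_ / _); apply: eq_bigr => s _.
  by rewrite mE -natr1 addrAC lerD2r.
rewrite cdfE.
apply: le_trans (@Phi_transfer _ mu0 v0 m V eps x v00 V0 close) _.
rewrite lerD2l ler_pM2l// ler_pM2r ?invr_gt0// VE.
rewrite (_ : w - _ - v0 = (w - v0) - (m - mu0) ^+ 2); last by ring.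
by apply: le_trans (ler_normB _ _) _; rewrite [X in _ + X <= _]ger0_norm ?sqr_ge0.
Qed.

End Transfer.

(** * The two Berry-Esseen bounds *)

Section BerryEsseen.
Variable R : realType.

Lemma standardized_cdf_dist_le1 n (P : probability 'S_n R) (X : 'S_n -> R) x :
  `|standardized_cdf P X x - Phi x| <= 1.
Proof.
have c0 : 0 <= standardized_cdf P X x by exact: fine_ge0.
have c1 : standardized_cdf P X x <= 1.
  by rewrite -lee_fin fineK ?fin_num_measure//; exact: probability_le1.
have := Phi_ge0 x; have := Phi_le1 x; rewrite ler_norml => ? ?; apply/andP; split; lra.
Qed.

Lemma invr_succ_le_sqrt n : (n.+1%:R : R)^-1 <= (Num.sqrt n.+1%:R)^-1.
Proof.
rewrite lef_pV2 ?posrE ?sqrtr_gt0 ?ltr0n//.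
have q1 : 1 <= Num.sqrt (n.+1%:R : R) by rewrite -[leLHS]sqrtr1 ler_sqrt ?ltr0n// ler1n.
by rewrite -[leRHS](sqr_sqrtr (ler0n R _)) expr2 ler_peMr ?sqrtr_ge0.
Qed.

(** The first two terms bound the distance to the Eulerian law and from there to the normal law. The
    mean is exact, and [24 = 2 * 12] is for a variance error of at most 1 against [(n + 1) / 12]. *)
Definition inv_const : R := pmf_const R * expR 4 + be_const R + 24.

Lemma inv_const_ge1 : 1 <= inv_const.
Proof.
have := be_const_ge R; have : 0 <= pmf_const R * expR 4.
  by rewrite mulr_ge0 ?expR_ge0// /pmf_const; have := be_const_ge R; lra.
by rewrite /inv_const; lra.
Qed.

Lemma involutions_berry_esseen n x : (0 < n)%N ->
  let P := uniform_on R (involutions n) in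
  (0 < 'V_P[@ndescents R n])%E ->
  `|standardized_cdf P (@ndescents R n) x - Phi x| <= inv_const / Num.sqrt n%:R.
Proof.
move=> n0 P V0; have [n1|n1] := ltnP 1 n; last first.
  have nE : n = 1%N by apply/eqP; rewrite eqn_leq n1.
  rewrite [X in Num.sqrt X%:R]nE sqrtr1 divr1 (le_trans (standardized_cdf_dist_le1 _ _ _))//.
  exact: inv_const_ge1.
have A0 : involutions n != finset.set0 by rewrite -card_gt0 card_involutions_gt0.
have N0 : 0 < #|involutions n|%:R :> R by rewrite ltr0n card_involutions_gt0.
have q0 : 0 < Num.sqrt (n.+1%:R : R) by rewrite sqrtr_gt0 ltr0n.
have v00 : 0 < n.+1%:R / 12 :> R by rewrite divr_gt0 ?ltr0n.
have close (y : R) : `|invF n y - Phi ((y - n.+1%:R / 2) / Num.sqrt (n.+1%:R / 12))| <=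
    (pmf_const R * expR 4 + be_const R) / Num.sqrt n.+1%:R.
  rewrite [leRHS]mulrDl (le_trans (ler_distD (eulerF n y) _ _))// lerD ?invF_close//.
  exact: eulerF_berry_esseen.
have := standardized_descents_close A0 x v00 close V0.
have -> : avg (involutions n) (fun s => #|descents s|.+1%:R) = n.+1%:R / 2 :> R.
  rewrite -[LHS]/(sum_inv n (fun d => d%:R) / #|involutions n|%:R).
  by rewrite sum_inv_mean// mulrC mulKf ?gt_eqF.
have -> : avg (involutions n) (fun s => (#|descents s|.+1%:R - n.+1%:R / 2) ^+ 2) =
    n.+1%:R / 12 + 2 * invg R n 1 / #|involutions n|%:R.
  rewrite -[LHS]/(sum_inv n (fun d => (d%:R - n.+1%:R / 2) ^+ 2) / #|involutions n|%:R).
  by rewrite sum_inv_second_moment// mulrDl [_ * (_ / 12)]mulrC mulfK ?gt_eqF.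
have w1 : `|2 * invg R n 1 / #|involutions n|%:R| <= 1.
  have w0 : 0 <= 2 * invg R n 1 by rewrite mulr_ge0 ?invg_ge0.
  rewrite ger0_norm; last exact: divr_ge0 w0 (ltW N0).
  rewrite ler_pdivrMr// mul1r (sum_inv_cst R n0).
  by have := invg_bound R n 1; rewrite expn1 muln1.
rewrite subrr normr0 mul0r addr0 expr0n addr0 [_ + _ - _]addrAC subrr add0r => /le_trans; apply.
have n1R : n.+1%:R != 0 :> R by rewrite pnatr_eq0.
apply: (@le_trans _ _ (inv_const / Num.sqrt n.+1%:R)).
  rewrite /inv_const [leRHS]mulrDl lerD2l.
  apply: (@le_trans _ _ (24 * (n.+1%:R)^-1)); last first.
    by rewrite ler_pM2l ?invr_succ_le_sqrt.
  rewrite -(_ : 2 * (1 / (n.+1%:R / 12)) = 24 * n.+1%:R^-1); last by field.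
  by rewrite ler_pM2l// ler_pM2r ?invr_gt0.
rewrite ler_pM2l; last by have := inv_const_ge1; lra.
by rewrite lef_pV2 ?posrE ?sqrtr_gt0 ?ltr0n// ler_sqrt ?ltr0n// ler_nat.
Qed.

(** [9144 = 72 + 9072]. Here [72 = 18 * 4] is the mean error over the standard deviation and
    [9072 = 2 * 12 * 378] the variance error, where [378 = 18 * 3 + 18^2] adds the squared mean
    error to that of the second moment. *)
Definition der_const : R := 18 * pmf_const R + be_const R + 9144.

Lemma der_const_gt0 : 0 < der_const.
Proof. by rewrite /der_const /pmf_const; have := be_const_ge R; lra. Qed.

Lemma derangements_berry_esseen n x : (1 < n)%N ->
  let P := uniform_on R (derangements n) in
  (0 < 'V_P[@ndescents R n])%E ->
  `|standardized_cdf P (@ndescents R n) x - Phi x| <= der_const / Num.sqrt n%:R.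
Proof.
move=> n1 P V0.
have N0 : 0 < #|derangements n|%:R :> R.
  by rewrite card_derangements mulr_gt0 ?ltr0n ?fact_gt0// (lt_le_trans _ (alt_ge R n1)).
have A0 : derangements n != finset.set0 by rewrite -card_gt0 -(ltr0n R).
have q0 : 0 < Num.sqrt (n.+1%:R : R) by rewrite sqrtr_gt0 ltr0n.
have q1 : 1 <= Num.sqrt (n.+1%:R : R) by rewrite -[leLHS]sqrtr1 ler_sqrt ?ltr0n// ler1n.
have v00 : 0 < n.+1%:R / 12 :> R by rewrite divr_gt0 ?ltr0n.
have close (y : R) : `|derF n y - Phi ((y - n.+1%:R / 2) / Num.sqrt (n.+1%:R / 12))| <=
    (18 * pmf_const R + be_const R) / Num.sqrt n.+1%:R.
  rewrite [leRHS]mulrDl -[in leRHS]mulrA (le_trans (ler_distD (eulerF n y) _ _))// lerD ?derF_close//.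
  exact: eulerF_berry_esseen.
have := standardized_descents_close A0 x v00 close V0.
have := der_mean_close R n1; have := der_second_moment_close R n1.
rewrite -/(avg (derangements n) (fun s => (#|descents s|.+1%:R - n.+1%:R / 2) ^+ 2)).
rewrite -/(avg (derangements n) (fun s => #|descents s|.+1%:R)).
set w := avg _ _; set m := avg _ _ => wle mle /le_trans; apply.
apply: (@le_trans _ _ (der_const / Num.sqrt n.+1%:R)); last first.
  rewrite ler_pM2l ?der_const_gt0//.
  by rewrite lef_pV2 ?posrE ?sqrtr_gt0 ?ltr0n ?(ltnW n1)// ler_sqrt ?ltr0n// ler_nat.
rewrite /der_const [leRHS]mulrDl -addrA lerD2l.
rewrite (_ : 9144 = 72 + 9072); last by ring.
rewrite [leRHS]mulrDl lerD//.
  rewrite (_ : 72 = 18 * 4) -?mulrA; last by ring.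
  by apply: ler_pM => //; exact: sqrt12.
have m2 : (m - n.+1%:R / 2) ^+ 2 <= 324 * Num.sqrt n.+1%:R.
  apply: (@le_trans _ _ 324); last by rewrite ler_peMr.
  by rewrite -real_normK ?num_real// (_ : 324 = 18 ^+ 2) ?ler_sqr ?nnegrE//; ring.
have n1E : n.+1%:R = Num.sqrt n.+1%:R ^+ 2 :> R by rewrite sqr_sqrtr ?ler0n.
apply: (@le_trans _ _ (2 * (378 * Num.sqrt n.+1%:R / (n.+1%:R / 12)))).
  by rewrite ler_pM2l// ler_pM2r ?invr_gt0//; lra.
rewrite [X in X / 12]n1E le_eqVlt; apply/orP; left; apply/eqP; field; exact: lt0r_neq0.
Qed.

End BerryEsseen.

Local Open Scope classical_set_scope.

Theorem theorem1p1 (R : realType) :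
  exists C C' : R, [/\ 0 < C, 0 < C',
    forall n : nat, (0 < n)%N ->
      let P := uniform_on R (involutions n) in
      (0 < 'V_P[@ndescents R n])%E ->
      (ereal_sup [set `|standardized_cdf P (@ndescents R n) x - Phi x|%:E
                 | x in [set: R]] <= (C / Num.sqrt n%:R)%:E)%E &
    forall n : nat, (2 <= n)%N ->
      let P := uniform_on R (derangements n) in
      (0 < 'V_P[@ndescents R n])%E ->
      (ereal_sup [set `|standardized_cdf P (@ndescents R n) x - Phi x|%:E
                 | x in [set: R]] <= (C' / n%:R `^ 3^-1)%:E)%E].
Proof.
exists (inv_const R), (der_const R); split.
- exact: lt_le_trans ltr01 (inv_const_ge1 R).
- exact: der_const_gt0.
- move=> n n0 P V0; apply: ge_ereal_sup => _ [x _ <-]; rewrite lee_fin.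
  exact: involutions_berry_esseen.
- move=> n n1 P V0; apply: ge_ereal_sup => _ [x _ <-]; rewrite lee_fin.
  apply: le_trans (derangements_berry_esseen x n1 V0) _.
  have n0 : (0 < n)%N by exact: ltnW.
  (* The rate [n^(-1/2)] already reached is at most [n^(-1/3)], since [1 <= n]. *)
  rewrite ler_pM2l ?der_const_gt0// lef_pV2 ?posrE ?sqrtr_gt0 ?powR_gt0 ?ltr0n//.
  by rewrite -powR12_sqrt ?ler0n// ler_powR ?ler1n// lef_pV2 ?posrE// ler_nat.
Qed.
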